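(* Let $f(x)=\frac12 x^TQx+p^Tx+r$ be a quadratic function on $\mathbb{R}^d$ with $Q$ symmetric positive definite, with smallest eigenvalue $\mu$ and largest eigenvalue $L$, $0<\mu<L$, and let $\kappa=L/\mu$. For each of the following choices of GMM parameters $(\alpha,\beta,\nu)$ it holds that $$r_{\mathbb{R}}(A_Q,B,T)=r_{\mathbb{C}}(A_Q,B,T)=H_\infty^{-1}=L_{2,*}^{-1}:$$ 1. (GD) $\alpha=\frac1L$, $\beta=\nu=0$; 2. (GD) $\alpha=\frac{2}{L+\mu}$, $\beta=\nu=0$; 3. (RS-GD) $\alpha=\frac{2}{L+\sqrt{L\mu}}$, $\beta=\nu=0$; 4. (NAG) $\alpha=\frac1L$, $\nu=\beta=\frac{1-1/\sqrt\kappa}{1+1/\sqrt\kappa}$; 5. (NAG) $\alpha=\frac{4}{3L+\mu}$, $\nu=\beta=\frac{\sqrt{3\kappa+1}-2}{\sqrt{3\kappa+1}+2}$; 6. (NAG) any $\alpha\in(0,\frac1L]$, $\nu=\beta=\frac{1-\sqrt{\alpha\mu}}{1+\sqrt{\alpha\mu}}$; 7. (TMM) $\alpha=\frac{1+\rho}{L}$, $\beta=\frac{\rho^2}{2-\rho}$, $\nu=\frac{\rho^2}{(1+\rho)(2-\rho)}$ with $\rho=1-\frac{1}{\sqrt\kappa}$; 8. (HB) $\alpha=\frac{4}{(\sqrt L+\sqrt\mu)^2}$, $\beta=\Big(\frac{\sqrt\kappa-1}{\sqrt\kappa+1}\Big)^2$, $\nu=0$; 9. (RS-HB) $\alpha=\frac{a^2(\kappa)}{L}$,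 $\beta=\Big(1-\frac{a(\kappa)}{\sqrt\kappa}\Big)^2$, $\nu=0$, where $a(\kappa)=\frac{\sqrt\kappa(\sqrt{2\kappa-1}-1)}{\kappa-1}$ if $\kappa\ge32$ and $a(\kappa)=1$ otherwise.
   Context: Generalized momentum method (GMM) with gradient errors $w_k\in\mathbb{R}^d$ and parameters $(\alpha,\beta,\nu)$: starting from $x_0=x_{-1}\in\mathbb{R}^d$, $$x_{k+1}=x_k-\alpha(\nabla f(y_k)+w_k)+\beta(x_k-x_{k-1}),\qquad y_k=x_k+\nu(x_k-x_{k-1}),\quad k\ge 0.$$ Let $x_*$ be the minimizer of $f$. $\ell_2$ gain (worst-case robustness): $L_{2,*}$ is the infimum of all $\gamma>0$ for which there is a function $\overline H:\mathbb{R}^d\to[0,\infty)$, independent of the error sequence, with $\overline H(x_* )=0$, such that for every initialization $x_0=x_{-1}\in\mathbb{R}^d$ and every square-summable $\{w_k\}_{k\ge0}\subset\mathbb{R}^d$, $$\sum_{k\ge0}(f(x_k)-f(x_* ))\le\gamma^2\sum_{k\ge0}\|w_k\|^2+\overline H(x_0).$$ Matrices: with $Q=U\Lambda U^T$ an orthogonal eigendecomposition (eigenvalues in increasing order), $$A_Q=\begin{bmatrix}(1+\beta)I_d-\alpha(1+\nu)Q & -\beta I_d+\alpha\nu Q\\ I_d & 0_d\end{bmatrix},\quad B=\begin{bmatrix}-\alpha I_d\\0_d\end{bmatrix},\quad T=\begin{bmatrix}\tfrac{1}{\sqrt2}\Lambda^{1/2}U^T & 0_d\end{bmatrix}.$$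 $\rho(\cdot)$ applied to a matrix is the spectral radius and $\|\cdot\|$ is the spectral norm. The $H_\infty$ norm (for $\rho(A_Q)<1$) is $H_\infty:=\max_{z\in\mathbb{C},|z|=1}\|G(z)\|$ with $G(z):=T(zI-A_Q)^{-1}B$. Stability radii: for $\mathbb{F}\in\{\mathbb{R},\mathbb{C}\}$ and $\varepsilon\ge0$, $\rho_\varepsilon^{\mathbb{F}}(A_Q,B,T):=\max_{\Delta\in\mathbb{F}^{d\times d},\|\Delta\|\le\varepsilon}\rho(A_Q+B\Delta T)$ and $r_{\mathbb{F}}(A_Q,B,T):=\inf\{\varepsilon>0:\rho_\varepsilon^{\mathbb{F}}(A_Q,B,T)\ge1\}$. *)

(* Defs.v *)
From HB Require Import structures.
From mathcomp Require Import all_boot all_order all_algebra.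
From mathcomp Require Import all_classical all_reals all_analysis.
From mathcomp Require Import complex.

Set Implicit Arguments.
Unset Strict Implicit.
Unset Printing Implicit Defensive.

Import Order.TTheory GRing.Theory Num.Theory.
Import numFieldNormedType.Exports.

Local Open Scope classical_set_scope.
Local Open Scope ring_scope.

Section EuclideanSpace.
Variables (R : realType) (d : nat).
Implicit Types (x : 'cV[R]_d) (f : 'cV[R]_d -> R).

(* The library norm on 'cV_d is the max norm, hence this explicit 2-norm. *)
Definition norm2 x : R := Num.sqrt (\sum_(i < d) x i ord0 ^+ 2).

Definition gradient f x : 'cV[R]_d :=
  \col_(i < d) 'D_(delta_mx i ord0) f x.

Definition is_minimizer f x := forall y, f x <= f y.

Definition quadratic (Q : 'M[R]_d) (p : 'cV[R]_d) (r : R) x : R :=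
  2^-1 * (x^T *m Q *m x) ord0 ord0 + (p^T *m x) ord0 ord0 + r.

Definition posdefmx (Q : 'M[R]_d) :=
  forall x, x != 0 -> 0 < (x^T *m Q *m x) ord0 ord0.

Definition is_min_eigenvalue (Q : 'M[R]_d) (mu : R) :=
  eigenvalue Q mu /\ forall a, eigenvalue Q a -> mu <= a.

Definition is_max_eigenvalue (Q : 'M[R]_d) (L : R) :=
  eigenvalue Q L /\ forall a, eigenvalue Q a -> a <= L.

(* Q = U Lambda U^T with Lambda = diag lam *)
Definition orthogonal_eigendecomposition (Q U : 'M[R]_d) (lam : 'rV[R]_d) :=
  [/\ U^T *m U = 1%:M,
      Q = U *m diag_mx lam *m U^T
    & forall i j : 'I_d, (i <= j)%N -> lam ord0 i <= lam ord0 j].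

End EuclideanSpace.

Section Method.
Variables (R : realType) (d : nat).
Implicit Types (f : 'cV[R]_d -> R) (w : nat -> 'cV[R]_d) (x : 'cV[R]_d).

(* The pair (x_k, x_(k-1)), started at x_0 = x_(-1). *)
Fixpoint gmm_state (alpha beta nu : R) f w x0 (k : nat)
    : 'cV[R]_d * 'cV[R]_d :=
  if k is k'.+1 then
    let: (x, xprev) := gmm_state alpha beta nu f w x0 k' in
    let y := x + nu *: (x - xprev) in
    (x - alpha *: (gradient f y + w k') + beta *: (x - xprev), x)
  else (x0, x0).

Definition gmm alpha beta nu f w x0 (k : nat) : 'cV[R]_d :=
  (gmm_state alpha beta nu f w x0 k).1.

Definition square_summable w := cvgn (series (fun k => norm2 (w k) ^+ 2)).

Definition l2_gain_bound (alpha beta nu : R) f (xs : 'cV[R]_d) (gamma : R) :=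
  exists H : 'cV[R]_d -> R,
    [/\ forall x, 0 <= H x,
        H xs = 0
      & forall x0 w, square_summable w ->
        (\sum_(0 <= k <oo) (f (gmm alpha beta nu f w x0 k) - f xs)%:E
          <= (gamma ^+ 2)%:E * \sum_(0 <= k <oo) (norm2 (w k) ^+ 2)%:E
             + (H x0)%:E)%E].

Definition l2_gain (alpha beta nu : R) f (xs : 'cV[R]_d) : \bar R :=
  ereal_inf [set gamma%:E | gamma in
    [set gamma : R | 0 < gamma /\ l2_gain_bound alpha beta nu f xs gamma]].

Definition gmm_A (alpha beta nu : R) (Q : 'M[R]_d) : 'M[R]_(d + d) :=
  block_mx ((1 + beta)%:M - (alpha * (1 + nu)) *: Q)
           (- beta%:M + (alpha * nu) *: Q)
           1%:M 0.

Definition gmm_B (alpha : R) : 'M[R]_(d + d, d) := col_mx (- alpha%:M) 0.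

Definition gmm_T (U : 'M[R]_d) (lam : 'rV[R]_d) : 'M[R]_(d, d + d) :=
  row_mx ((Num.sqrt 2)^-1 *: (diag_mx (map_mx Num.sqrt lam) *m U^T)) 0.

End Method.

Section ComplexMatrices.
Variable R : realType.

Definition complexify m n (M : 'M[R]_(m, n)) : 'M[R[i]]_(m, n) :=
  map_mx (real_complex R) M.

(* `|z| lives in R[i]; Normc.normc z is the same modulus as an element of R. *)
Definition cnorm2 n (v : 'cV[R[i]]_n) : R :=
  Num.sqrt (\sum_(i < n) Normc.normc (v i ord0) ^+ 2).

Definition spectral_norm m n (M : 'M[R[i]]_(m, n)) : R :=
  sup [set cnorm2 (M *m v) | v in [set v : 'cV[R[i]]_n | cnorm2 v <= 1]].

Definition spectral_radius n (M : 'M[R[i]]_n) : R :=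
  sup [set Normc.normc a | a in [set a : R[i] | eigenvalue M a]].

End ComplexMatrices.

(* Linear systems (A, B, T). Suprema over z and Delta are taken in \bar R, so
   that no boundedness is presupposed; in \bar R, 0^-1 = +oo and
   +oo^-1 = 0. *)
Section RobustnessMeasures.
Variables (R : realType) (n d : nat).
Variables (A : 'M[R]_n) (B : 'M[R]_(n, d)) (T : 'M[R]_(d, n)).

Definition transfer (z : R[i]) : 'M[R[i]]_d :=
  complexify T *m invmx (z%:M - complexify A) *m complexify B.

(* Meaningful when the spectral radius of A is < 1: then z%:M - A is
   invertible on the unit circle and the supremum is a maximum. *)
Definition Hinf_norm : \bar R :=
  ereal_sup [set (spectral_norm (transfer z))%:E
            | z in [set z : R[i] | Normc.normc z = 1]].

(* D is the set of admissible perturbations: all complex matrices, or those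
   with real entries. The spectral norm of a real matrix is that of its
   complexification. *)
Definition perturbed_radius (D : set 'M[R[i]]_d) (eps : R) : \bar R :=
  ereal_sup [set (spectral_radius
                    (complexify A + complexify B *m Delta *m complexify T))%:E
            | Delta in D `&` [set Delta | spectral_norm Delta <= eps]].

Definition stability_radius_over (D : set 'M[R[i]]_d) : \bar R :=
  ereal_inf [set eps%:E | eps in
    [set eps : R | 0 < eps /\ (1 <= perturbed_radius D eps)%E]].

Definition stability_radiusR : \bar R :=
  stability_radius_over (range (@complexify R d d)).

Definition stability_radiusC : \bar R := stability_radius_over setT.

End RobustnessMeasures.

Section MethodChoices.
Variables (R : realType) (mu L : R).
Let kappa : R := L / mu.

Definition rshb_a (k : R) : R :=
  if 32 <= k then Num.sqrt k * (Num.sqrt (2 * k - 1) - 1) / (k - 1) else 1.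

(* Arguments of the predicate: alpha, beta, nu. *)
Inductive gmm_parameters : R -> R -> R -> Prop :=
| GD_popular : gmm_parameters L^-1 0 0
| GD_fastest : gmm_parameters (2 / (L + mu)) 0 0
| RS_GD : gmm_parameters (2 / (L + Num.sqrt (L * mu))) 0 0
| NAG_popular :
    let beta := (1 - 1 / Num.sqrt kappa) / (1 + 1 / Num.sqrt kappa) in
    gmm_parameters L^-1 beta beta
| NAG_fastest :
    let beta := (Num.sqrt (3 * kappa + 1) - 2) /
                (Num.sqrt (3 * kappa + 1) + 2) in
    gmm_parameters (4 / (3 * L + mu)) beta beta
| NAG_range (alpha : R) : 0 < alpha <= L^-1 ->
    let beta := (1 - Num.sqrt (alpha * mu)) / (1 + Num.sqrt (alpha * mu)) in
    gmm_parameters alpha beta beta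
| TMM :
    let rho := 1 - 1 / Num.sqrt kappa in
    gmm_parameters ((1 + rho) / L) (rho ^+ 2 / (2 - rho))
                   (rho ^+ 2 / ((1 + rho) * (2 - rho)))
| HB :
    gmm_parameters (4 / (Num.sqrt L + Num.sqrt mu) ^+ 2)
      (((Num.sqrt kappa - 1) / (Num.sqrt kappa + 1)) ^+ 2) 0
| RS_HB :
    gmm_parameters (rshb_a kappa ^+ 2 / L)
      ((1 - rshb_a kappa / Num.sqrt kappa) ^+ 2) 0.

End MethodChoices.

(* Main.v *)
Require Import Defs.
From mathcomp Require Import all_boot all_order all_algebra.
From mathcomp Require Import all_classical all_reals all_analysis.
From mathcomp Require Import complex zify ring lra.

Set Implicit Arguments.
Unset Strict Implicit.
Unset Printing Implicit Defensive.

Import Order.TTheory GRing.Theory Num.Theory.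
Import numFieldNormedType.Exports.

Local Open Scope classical_set_scope.
Local Open Scope ring_scope.

(** The orthogonal matrix U decouples the method: with xi = U^T (x - xs), the
    i-th coordinate obeys x2 = a x1 - c x0 - alpha w, where z^2 - a z + c is
    the characteristic polynomial p_i(z) of the mode with eigenvalue lam_i,
    a = 1 + beta - alpha (1 + nu) lam_i and c = beta - alpha nu lam_i. The
    transfer function is, up to orthogonal factors, diagonal with entries of
    modulus alpha sqrt(lam_i / 2) / |p_i(z)| on the unit circle. At z = 1 the
    denominator is alpha lam_i, so that the largest entry comes from mu; at
    z = -1 the largest one comes from L. Put

      h = max (1 / sqrt (2 mu), alpha sqrt (L / 2) / p_L(-1)).

    Everything follows from the fact that h bounds all modes on the whole
    circle: the worst frequency is then real, hence attained by a real
    perturbation and by a real disturbance.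

    The bound is not obtained from a frequency-domain estimate. For every mode
    and e_i = alpha^2 lam_i / (2 h^2), [storage_exists] gives an explicit
    nonnegative quadratic form V with

      e_i x1^2 + V (x2, x1) <= (x2 - a x1 + c x0)^2 + V (x1, x0)

    for all reals x0, x1, x2. This one inequality has two uses. Summed along a
    trajectory it telescopes and gives the l2 gain bound h, the function of the
    initial point being the initial value of the storage
    ([l2_gain_bound_certified]). Evaluated at the real and imaginary parts of
    1, z, z^2 it gives e_i |z|^2 <= |p_i(z)|^2 for |z| >= 1, and almost so for
    |z| slightly below 1 ([storage_near_circle]). Hence the transfer function
    is bounded by h, and a perturbation of norm at most eps < 1 / h leaves all
    eigenvalues in a disk of radius eta < 1 that depends only on eps
    ([perturbed_eigenvalue_bound]).

    The converse bounds come from the critical mode, where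
    h p_i(sigma) = alpha sqrt(lam_i / 2) with sigma = 1 or -1. There the
    transfer function has gain h, a real rank-one matrix of norm 1 / h moves an
    eigenvalue to sigma, and long pulses sigma^k, started at the minimizer,
    have a gain that tends to h ([l2_gain_bound_ge]).

    What depends on the parameters is [admissible]: stability of every mode,
    and a bound on those modes whose modulus on the circle is smallest at a
    non-real point. [admissible_params] checks it for the families of
    gradient descent, accelerated gradient, heavy ball and triple momentum. *)

(** * Quadratic storage functions for a second-order recurrence *)

Definition qform (R : realFieldType) (v11 v12 v22 x y : R) : R :=
  v11 * x ^+ 2 + 2 * v12 * x * y + v22 * y ^+ 2.

Lemma qform_ge0 (R : realFieldType) (v11 v12 v22 x y : R) :
  0 <= v11 -> 0 <= v22 -> v12 ^+ 2 <= v11 * v22 ->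
  0 <= qform v11 v12 v22 x y.
Proof.
move=> v11_ge0 v22_ge0 det_ge0; rewrite /qform.
have [v11_0|v11_neq0] := eqVneq v11 0.
  have /eqP : v12 ^+ 2 = 0.
    by apply/le_anti; rewrite sqr_ge0 andbT (le_trans det_ge0)// v11_0 mul0r.
  rewrite sqrf_eq0 => /eqP ->.
  by rewrite v11_0 mul0r mulr0 !mul0r !add0r mulr_ge0// sqr_ge0.
have v11_gt0 : 0 < v11 by rewrite lt_neqAle eq_sym v11_neq0.
rewrite -(pmulr_rge0 _ v11_gt0).
have -> : v11 * (v11 * x ^+ 2 + 2 * v12 * x * y + v22 * y ^+ 2) =
  (v11 * x + v12 * y) ^+ 2 + (v11 * v22 - v12 ^+ 2) * y ^+ 2 by ring.
by rewrite addr_ge0 ?sqr_ge0// mulr_ge0 ?sqr_ge0// subr_ge0.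
Qed.

(** V is a storage function for the recurrence x2 = a x1 - c x0 + u with supply
    rate u^2 - e x1^2: the energy e x1^2 of the output and the increase of V are
    paid for by the input. *)
Definition storage (R : realFieldType) (a c e v11 v12 v22 : R) :=
  (forall x y, 0 <= qform v11 v12 v22 x y) /\
  (forall x2 x1 x0, e * x1 ^+ 2 + qform v11 v12 v22 x2 x1
     <= (x2 - a * x1 + c * x0) ^+ 2 + qform v11 v12 v22 x1 x0).

(** With these coefficients of V, the slack of the dissipation inequality is a
    quadratic form in (x2 + x0, x1) plus a multiple of (x2 - x0)^2. On the
    circle x2 + x0 and x2 - x0 are x1 times 2 cos t and 2 i sin t, so this is
    the decomposition of a quadratic polynomial in cos t that is nonnegative on
    [-1, 1] as one that is nonnegative on the line plus a multiple of sin^2 t;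
    k is the only free parameter. The two determinant hypotheses make V and the
    form in (x2 + x0, x1) nonnegative. *)
Lemma storage_of_multiplier (R : realFieldType) (a c e k : R) :
  k <= 1 -> c ^+ 2 <= k -> c <= k -> - c <= k ->
  0 <= 1 + a ^+ 2 + c ^+ 2 - e - 2 * k ->
  (a * (1 - c) / 2) ^+ 2 <= (1 - k) * (k - c ^+ 2) ->
  (a * (1 + c) / 2) ^+ 2 <= (k + c) / 2 * (1 + a ^+ 2 + c ^+ 2 - e - 2 * k) ->
  storage a c e (1 - k) (- (a * (1 - c) / 2)) (k - c ^+ 2).
Proof.
move=> k1 c2k ck Nck C0 det1 det2; split=> [x y|x2 x1 x0].
  by apply: qform_ge0; rewrite ?subr_ge0// sqrrN.
rewrite -subr_ge0.
have := @qform_ge0 _ ((k + c) / 2) (- (a * (1 + c) / 2))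
  (1 + a ^+ 2 + c ^+ 2 - e - 2 * k) (x2 + x0) x1.
rewrite sqrrN => /(_ _ C0 det2)/= q_ge0.
have -> : (x2 - a * x1 + c * x0) ^+ 2 +
    qform (1 - k) (- (a * (1 - c) / 2)) (k - c ^+ 2) x1 x0 -
    (e * x1 ^+ 2 + qform (1 - k) (- (a * (1 - c) / 2)) (k - c ^+ 2) x2 x1) =
    qform ((k + c) / 2) (- (a * (1 + c) / 2)) (1 + a ^+ 2 + c ^+ 2 - e - 2 * k)
      (x2 + x0) x1 + (k - c) / 2 * (x2 - x0) ^+ 2.
  by rewrite /qform; field.
rewrite addr_ge0 ?q_ge0//; first by lra.
by rewrite mulr_ge0 ?sqr_ge0//; lra.
Qed.

(** On the unit circle |z^2 - a z + c|^2 is a quadratic polynomial in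
    x = cos t with leading coefficient 4 c. If c > 0 and |a| (1 + c) <= 4 c, its
    vertex is in [-1, 1], with value (1 - c)^2 (4 c - a^2) / (4 c), and k = c
    puts all the slack in the form in (x2 + x0, x1). Otherwise its minimum
    (1 + c - |a|)^2 is at an endpoint, and k is chosen so that, if e equals this
    minimum, that form is the square of a linear form vanishing there. In the
    first case 4 c - a^2 >= 4 c (1 + c - |a|) / (1 + c), so the last hypothesis,
    linear in 1 + c - |a|, implies that e is at most the vertex value. *)
Lemma storage_exists (R : realFieldType) (a c e : R) :
  - 1 < c < 1 -> `|a| < 1 + c -> 0 <= e <= (1 + c - `|a|) ^+ 2 ->
  (`|a| * (1 + c) <= 4 * c ->
     (1 + c) * e <= (1 - c) ^+ 2 * (1 + c - `|a|)) ->
  exists v11 v12 v22, storage a c e v11 v12 v22.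
Proof.
move=> /andP[c_gtN1 c_lt1] a_lt /andP[e_ge0 e_le] interior.
have a_ge0 : 0 <= `|a| by exact: normr_ge0.
have a2 : a ^+ 2 = `|a| ^+ 2 by rewrite real_normK ?num_real.
have [int|/ltW ext] := leP (`|a| * (1 + c)) (4 * c).
  move/(_ int): interior => {}interior.
  exists (1 - c), (- (a * (1 - c) / 2)), (c - c ^+ 2).
  move: `|a| a2 a_ge0 a_lt e_le int interior => A a2 A0 A1 e_le int interior.
  have c0 : 0 <= c by nra.
  have A2 : A ^+ 2 <= 4 * c by nra.
  have C2 : A ^+ 2 * (1 + c) ^+ 2 / 4 <= c * (1 + A ^+ 2 + c ^+ 2 - e - 2 * c).
    rewrite -subr_ge0.
    have E : 0 <= (1 + c) * (c * ((1 - c) ^+ 2 + A ^+ 2 - e) - A ^+ 2 * (1 +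
      c) ^+ 2 / 4).
      have E1 : 0 <= c * ((1 - c) ^+ 2 * (1 + c - A) - (1 + c) * e).
        by rewrite mulr_ge0// subr_ge0.
      have E2 : 0 <= (1 - c) ^+ 2 * A * (4 * c - A * (1 + c)).
        by rewrite mulr_ge0 ?subr_ge0// mulr_ge0// sqr_ge0.
      suff -> : (1 + c) * (c * ((1 - c) ^+ 2 + A ^+ 2 - e) - A ^+ 2 * (1 +
        c) ^+ 2 / 4) = c * ((1 - c) ^+ 2 * (1 + c - A) - (1 + c) * e) + (1 -
        c) ^+ 2 * A * (4 * c - A * (1 + c)) / 4.
        by rewrite addr_ge0// divr_ge0.
      by field.
    have c1 : 0 < 1 + c by lra.
    rewrite (pmulr_rge0 _ c1) in E.
    by rewrite subr_ge0 in E; rewrite subr_ge0; apply: le_trans E _;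
      rewrite le_eqVlt; apply/orP; left; apply/eqP; ring.
  apply: storage_of_multiplier => //.
  - by rewrite ltW.
  - nra.
  - nra.
  - rewrite a2.
    have [c_eq0|c_neq0] := eqVneq c 0.
      have A_eq0 : A = 0 by subst c; nra.
      by subst A; rewrite c_eq0 in e_le *; nra.
    have c_gt0 : 0 < c by rewrite lt_neqAle eq_sym c_neq0.
    rewrite -(pmulr_rge0 _ c_gt0); apply: le_trans C2.
    by rewrite divr_ge0// -exprMn sqr_ge0.
  - by rewrite expr_div_n exprMn a2; nra.
  - rewrite expr_div_n exprMn a2.
    rewrite (_ : (c + c) / 2 = c); last by field.
    by apply: le_trans C2; rewrite le_eqVlt; apply/orP; left; apply/eqP; field.
exists (1 - (`|a| * (1 + c) / 2 - c)), (- (a * (1 - c) / 2)),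
  ((`|a| * (1 + c) / 2 - c) - c ^+ 2).
move: `|a| a2 a_ge0 a_lt e_le ext {interior} => A a2 A0 A1 e_le ext.
have cA : 2 * c <= A by nra.
apply: storage_of_multiplier => //.
- nra.
- nra.
- lra.
- nra.
- rewrite a2; nra.
- rewrite expr_div_n exprMn a2.
  rewrite -subr_ge0.
  set D := (X in 0 <= X).
  have -> : D = (1 + c - A) / 2 * (A * (1 + c ^+ 2) - 2 * c * (1 + c)).
    by rewrite /D; field.
  rewrite mulr_ge0//; first by lra.
  nra.
- rewrite expr_div_n exprMn a2 (_ : (A * (1 + c) / 2 - c + c) / 2 =
  A * (1 + c) / 4); last by field.
  rewrite -subr_ge0.
  set D := (X in 0 <= X).
  have -> : D = A * (1 + c) / 4 * ((1 + c - A) ^+ 2 - e) by rewrite /D; field.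
  by rewrite mulr_ge0 ?subr_ge0//; nra.
Qed.

(** * The parameter choices *)

Section Modes.
Variables (R : rcfType) (alpha beta nu : R).
Definition mode_trace (l : R) : R := 1 + beta - alpha * (1 + nu) * l.
Definition mode_det (l : R) : R := beta - alpha * nu * l.
(** The value at -1 of the characteristic polynomial z^2 - mode_trace z +
    mode_det. *)
Definition mode_at_N1 (l : R) : R := 2 * (1 + beta) - alpha * (1 + 2 * nu) * l.
End Modes.

(** With a and c the trace and the determinant of a mode, 1 + c - a = alpha l
    is positive and 1 + c + a is smallest at l = L, so that the Jury
    conditions reduce to -1 < c < 1 and the positivity at -1 for L. The other
    condition concerns modes whose modulus on the circle has its minimum at a
    non-real point (case |a| (1 + c) <= 4 c): they are compared with the value at 1 of
    the mode mu if a >= 0, and with the value at -1 of the mode L if a < 0. *)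
Definition admissible (R : rcfType) (mu L alpha beta nu : R) : Prop :=
  [/\ 0 < alpha, 0 <= nu, 0 < mode_at_N1 alpha beta nu L &
   forall l, mu <= l <= L ->
     let a := mode_trace alpha beta nu l in
     let c := mode_det alpha beta nu l in
     -1 < c < 1 /\
     (`|a| * (1 + c) <= 4 * c ->
       (0 <= a -> (1 + c) * (alpha * mu) <= (1 - c) ^+ 2) /\
       (a < 0 -> (1 + c) * (l / L * mode_at_N1 alpha beta nu L) <=
         (1 - c) ^+ 2))].

(** The two bounds on e are those of the gain at z = 1 for mu and at z = -1 for
    L. They bound (1 + c - a)^2 and (1 + c + a)^2 from below, as
    1 + c - a = alpha l and 1 + c + a decreases in l. *)
Lemma admissible_storage (R : rcfType) (mu L alpha beta nu l e : R) :
  0 < mu -> admissible mu L alpha beta nu -> mu <= l <= L ->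
  0 <= e -> e <= alpha ^+ 2 * l * mu ->
  e <= l / L * mode_at_N1 alpha beta nu L ^+ 2 ->
  exists v11 v12 v22, storage (mode_trace alpha beta nu l)
    (mode_det alpha beta nu l) e v11 v12 v22.
Proof.
move=> mu_gt0 [al_gt0 nu_ge0 N_gt0 adm] l_itv e_ge0 e_le1 e_leN.
have /adm/= [c_itv int] := l_itv; have /andP[mu_l l_L] := l_itv.
have l_gt0 : 0 < l by lra.
have L_gt0 : 0 < L by lra.
have lL1 : l / L <= 1 by rewrite ler_pdivrMr// mul1r.
have lL0 : 0 <= l / L by rewrite divr_ge0// ltW.
have ac1 : 1 + mode_det alpha beta nu l - mode_trace alpha beta nu l =
  alpha * l.
  by rewrite /mode_det /mode_trace; ring.
have acN : mode_at_N1 alpha beta nu L <=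
  1 + mode_det alpha beta nu l + mode_trace alpha beta nu l.
  rewrite /mode_det /mode_trace /mode_at_N1 -subr_ge0.
  set D := (X in 0 <= X).
  have -> : D = alpha * (1 + 2 * nu) * (L - l) by rewrite /D; ring.
  by rewrite !mulr_ge0//; lra.
move: (mode_det alpha beta nu l) (mode_trace alpha beta nu l)
  ac1 acN c_itv int => c a ac1 acN c_itv int.
move: (mode_at_N1 alpha beta nu L) acN N_gt0 e_leN int {adm} =>
  N acN N_gt0 e_leN int.
have c1_gt0 : 0 < 1 + c by case/andP: c_itv; lra.
have al_l : 0 < alpha * l by rewrite mulr_gt0.
have al_mu : 0 < alpha * mu by rewrite mulr_gt0.
apply: storage_exists => //.
- by rewrite ltr_norml; apply/andP; split; lra.
- rewrite e_ge0/=; have [a_ge0|a_lt0] := ger0P a.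
    by rewrite ac1 (le_trans e_le1)// exprMn mulrA expr2 -!mulrA !ler_pM2l.
  apply: le_trans e_leN _; apply: (@le_trans _ _ (N ^+ 2)).
    by rewrite ler_piMl ?sqr_ge0.
  by rewrite ler_sqr ?nnegrE//; lra.
- move=> /int[int1 intN]; have [a_ge0|a_lt0] := ger0P a.
    rewrite ac1; apply: (@le_trans _ _ ((1 + c) * (alpha * mu) * (alpha * l))).
      rewrite -mulrA ler_pM2l// (le_trans e_le1)//.
      by rewrite le_eqVlt; apply/orP; left; apply/eqP; ring.
    by rewrite ler_pM2r// int1.
  rewrite opprK; apply: (@le_trans _ _ ((1 + c) * (l / L * N) * N)).
    by rewrite -!mulrA ler_pM2l// (le_trans e_leN)// expr2 !mulrA.
  have N_ge0 : 0 <= N by exact: ltW.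
  by apply: ler_pM => //; [rewrite mulr_ge0 ?(ltW c1_gt0)// mulr_ge0|exact:
    intN].
Qed.

Section Families.
Variables (R : rcfType) (mu L : R).
Hypothesis muL : 0 < mu < L.

Lemma admissible_gd alpha : 0 < alpha -> alpha * L < 2 -> alpha * mu <= 1 ->
  admissible mu L alpha 0 0.
Proof.
move=> al_gt0 alL almu; have /andP[mu0 muL'] := muL.
split => //; first by rewrite /mode_at_N1; lra.
move=> l /andP[l1 l2]; rewrite /mode_det /mode_trace /=.
rewrite !mulr0 !mul0r !subrr !subr0 !addr0 !mulr1 mulr0 normr_le0.
split; first by apply/andP; split; lra.
by move=> /eqP ->; rewrite ltxx mul1r expr1n; split.
Qed.

(** With t = 1 - alpha l, a = (1 + b) t and c = b t have the same sign, so a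
    minimum at a non-real point needs t >= 0; then (1 + b) (1 + b t) <= 4 b, that
    is c <= 1 - 2 s, and (1 - c)^2 >= 4 s^2 covers (1 + c) s^2. *)
Lemma admissible_nag alpha s : 0 < s -> s ^+ 2 = alpha * mu -> 0 < alpha ->
  alpha * L <= 4 / 3 -> s < 1 ->
  let b := (1 - s) / (1 + s) in admissible mu L alpha b b.
Proof.
move=> s_gt0 s2 al_gt0 alL s_lt1 b; have /andP[mu0 muL'] := muL.
have bs : b * (1 + s) = 1 - s by rewrite /b; field; lra.
have b0 : 0 < b by rewrite /b divr_gt0; lra.
have b1 : b < 1 by nra.
split => //; first by lra.
  rewrite /mode_at_N1.
  have : alpha * L * (1 + 2 * b) <= 4 / 3 * (1 + 2 * b) by rewrite ler_wpM2r//;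
    lra.
  by nra.
move=> l /andP[l1 l2]; rewrite /mode_det /mode_trace /=.
have all0 : 0 < alpha * l by rewrite mulr_gt0//; lra.
have allL : alpha * l <= alpha * L by rewrite ler_pM2l.
pose t := 1 - alpha * l.
have -> : 1 + b - alpha * (1 + b) * l = (1 + b) * t by rewrite /t; ring.
have -> : b - alpha * b * l = b * t by rewrite /t; ring.
have t1 : t < 1 by rewrite /t; lra.
have tN : - 1 / 3 <= t by rewrite /t; lra.
have ct : - 1 < b * t < 1 by apply/andP; split; nra.
split=> //; rewrite normrM gtr0_norm; last by lra.
move=> int.
have c1 : 0 < 1 + b * t by case/andP: ct; lra.
have t0 : 0 <= t.
  have : 0 <= 4 * (b * t) by apply: le_trans int; rewrite !mulr_ge0//; lra.
  by rewrite !pmulr_rge0.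
split; last by move=> ?; exfalso; nra.
move=> _; rewrite -s2; rewrite ger0_norm// in int.
have [t_eq0|t_neq0] := eqVneq t 0.
  by rewrite t_eq0 mulr0 addr0 subr0 mul1r expr1n; nra.
have t_gt0 : 0 < t by rewrite lt_neqAle eq_sym t_neq0.
have int' : (1 + b) * (1 + b * t) <= 4 * b.
  by rewrite -(ler_pM2r t_gt0); move: int; rewrite mulrAC !mulrA.
have : 2 * (1 + b * t) <= 4 * (1 - s).
  have : (1 + b) * (1 + b * t) * (1 + s) <=
    4 * b * (1 + s) by rewrite ler_pM2r//; lra.
  rewrite -[4 * b * _]mulrA bs.
  suff -> : (1 + b) * (1 + b * t) * (1 + s) = 2 * (1 + b * t) by [].
  suff -> : (1 + b) * (1 + b * t) * (1 + s) =
    (1 + s + b * (1 + s)) * (1 + b * t) by rewrite bs; ring.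
  by ring.
move: ct; move: (b * t) => c /andP[? ?] ?.
have ? : 2 * s <= 1 - c by lra.
nra.
Qed.

(** Heavy ball tuned so that the mode mu has the double root g. The first
    alternative makes the mode L have the double root -g, and its value
    (1 - g)^2 at -1 is the term of comparison; under the second one no mode has
    a negative trace. *)
Lemma admissible_hb alpha g : 0 < alpha -> 0 <= g < 1 ->
  alpha * mu = (1 - g) ^+ 2 ->
  alpha * L = (1 + g) ^+ 2 \/ alpha * L <= 1 + g ^+ 2 ->
  admissible mu L alpha (g ^+ 2) 0.
Proof.
move=> al_gt0 /andP[g0 g1] almu alL; have /andP[mu0 muL'] := muL.
have N_gt0 : 0 < mode_at_N1 alpha (g ^+ 2) 0 L.
  rewrite /mode_at_N1 mulr0 addr0 mulr1; case: alL => alL; last by nra.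
  have : 0 < (1 - g) ^+ 2 by rewrite exprn_gt0//; lra.
  by rewrite alL; lra.
split => //.
move=> l /andP[l1 l2]; rewrite /mode_det /mode_trace /=.
rewrite mulr0 mul0r subr0 addr0 mulr1; split; first by apply/andP; split; nra.
have gg : (1 + g ^+ 2) * (1 - g) ^+ 2 <= (1 - g ^+ 2) ^+ 2.
  have -> : (1 - g ^+ 2) ^+ 2 = (1 + g) ^+ 2 * (1 - g) ^+ 2 by ring.
  by rewrite ler_wpM2r ?sqr_ge0//; nra.
move=> _; split=> [_|]; first by rewrite almu.
have allL : alpha * l <= alpha * L by rewrite ler_pM2l.
have L_gt0 : 0 < L by lra.
case: alL => alL a_lt0; last by exfalso; lra.
rewrite /mode_at_N1 mulr0 addr0 mulr1 alL.
have -> : 2 * (1 + g ^+ 2) - (1 + g) ^+ 2 = (1 - g) ^+ 2 by ring.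
apply: le_trans gg; rewrite ler_wpM2l//; first by nra.
by rewrite ler_piMl ?sqr_ge0// ler_pdivrMr// mul1r.
Qed.

(** In terms of u = (1 - l / L) / (rho (2 - rho)), which runs over [0, 1], the
    modes have c = rho^3 u and a = rho ((2 + rho) u - 1), and the value at -1
    for L is 1 - rho. If a >= 0 the crude bound c <= rho^3 is enough because
    1 - rho^3 has the factor 1 - rho; if a < 0 then u < 1 / (2 + rho) makes
    3 c <= rho. *)
Lemma admissible_tmm rho : 0 < rho < 1 -> mu = (1 - rho) ^+ 2 * L ->
  admissible mu L ((1 + rho) / L) (rho ^+ 2 / (2 - rho)) (rho ^+ 2 /
    ((1 + rho) * (2 - rho))).
Proof.
move=> /andP[r0 r1] muE; have /andP[mu0 muL'] := muL.
have L_gt0 : 0 < L by lra.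
have r20 : 2 - rho != 0 by lra.
have r10 : 1 + rho != 0 by lra.
have L0 : L != 0 by lra.
have NE : mode_at_N1 ((1 + rho) / L) (rho ^+ 2 / (2 - rho)) (rho ^+ 2 /
  ((1 + rho) * (2 - rho))) L = 1 - rho.
  by rewrite /mode_at_N1; field; rewrite L0 r20 r10.
split.
- by rewrite divr_gt0//; lra.
- by rewrite divr_ge0 ?sqr_ge0// mulr_ge0; lra.
- by rewrite NE; lra.
move=> l /andP[l1 l2]; rewrite NE /=.
pose u := (1 - l / L) / (rho * (2 - rho)).
have tauE : l / L = 1 - rho * (2 - rho) * u by rewrite /u; field;
  rewrite L0 r20; lra.
have lL1 : l / L <= 1 by rewrite ler_pdivrMr// mul1r.
have lL0 : 0 <= l / L by rewrite divr_ge0//; lra.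
have lLm : (1 - rho) ^+ 2 <= l / L by rewrite ler_pdivlMr// -muE.
have u0 : 0 <= u by rewrite /u divr_ge0//; [lra|rewrite mulr_ge0//; lra].
have u1 : u <= 1.
  rewrite /u ler_pdivrMr; last by rewrite mulr_gt0//; lra.
  by rewrite mul1r; lra.
have -> : mode_det ((1 + rho) / L) (rho ^+ 2 / (2 - rho)) (rho ^+ 2 /
  ((1 + rho) * (2 - rho))) l = rho ^+ 3 * u.
  by rewrite /mode_det /u; field; rewrite L0 r20 r10; lra.
have -> : mode_trace ((1 + rho) / L) (rho ^+ 2 / (2 - rho)) (rho ^+ 2 /
  ((1 + rho) * (2 - rho))) l = rho * ((2 + rho) * u - 1).
  by rewrite /mode_trace /u; field; rewrite L0 r20 r10; lra.
have r3 : 0 < rho ^+ 3 < rho by rewrite exprn_gt0//= -[X in _ <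
  X]expr1 ltr_iXn2l.
have r3m : 1 - rho ^+ 3 = (1 - rho) * (1 + rho + rho ^+ 2) by ring.
move/andP: r3 => [r30 r31].
have c0 : 0 <= rho ^+ 3 * u by rewrite mulr_ge0// ltW.
have c1 : rho ^+ 3 * u <= rho ^+ 3 by rewrite ler_piMr// ltW.
split; first by apply/andP; split; lra.
move=> _; split=> [_|a_lt0].
  have -> : (1 + rho) / L * mu = (1 + rho) * (1 - rho) ^+ 2.
    by rewrite muE; field.
  apply: (@le_trans _ _ ((1 - rho ^+ 3) ^+ 2)); last first.
    by rewrite ler_sqr ?nnegrE; lra.
  apply: (@le_trans _ _ ((1 + rho ^+ 3) * ((1 + rho) * (1 - rho) ^+ 2))).
    by rewrite ler_wpM2r//; [rewrite mulr_ge0 ?sqr_ge0//; lra|lra].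
  rewrite r3m exprMn mulrA mulrC ler_wpM2l ?sqr_ge0//.
  have : 1 + rho ^+ 3 <= 1 + rho + rho ^+ 2 by nra.
  have : 1 + rho <= 1 + rho + rho ^+ 2 by nra.
  move=> ? ?; rewrite expr2 ler_pM//; lra.
have ur : (2 + rho) * u < 1 by nra.
have cr : 3 * (rho ^+ 3 * u) <= rho.
  have r2u : 3 * (rho ^+ 2 * u) <= 1 by nra.
  rewrite (_ : 3 * (rho ^+ 3 * u) = rho * (3 * (rho ^+ 2 * u))); last by ring.
  by rewrite ler_piMr// ltW.
move: (rho ^+ 3 * u) c0 c1 cr => c c0 c1 cr.
apply: (@le_trans _ _ ((1 + c) * (1 - rho))); last by nra.
by rewrite ler_pM2l ?ler_piMl//; lra.
Qed.

End Families.

Lemma admissible_params (R : realType) (mu L alpha beta nu : R) : 0 < mu < L ->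
  gmm_parameters mu L alpha beta nu -> admissible mu L alpha beta nu.
Proof.
move=> muL params; have /andP[mu_gt0 mu_lt_L] := muL.
have L_gt0 : 0 < L by lra.
have mu_neq0 : mu != 0 by lra.
have L_neq0 : L != 0 by lra.
pose q := Num.sqrt (L / mu).
have q2 : q ^+ 2 = L / mu by rewrite sqr_sqrtr// divr_ge0// ltW.
have q2mu : q ^+ 2 * mu = L by rewrite q2; field.
have q_gt1 : 1 < q.
  rewrite -[X in X < _]sqrtr1 ltr_sqrt ?divr_gt0//.
  by rewrite ltr_pdivlMr// mul1r.
have q_neq0 : q != 0 by lra.
have iq : 0 < 1 / q < 1.
  by rewrite divr_gt0 ?ltr_pdivrMr ?mul1r//; lra.
have iq2 : (1 / q) ^+ 2 = L^-1 * mu by rewrite expr_div_n q2; field;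
  rewrite L_neq0.
have Lmu : L^-1 * mu < 1 by rewrite mulrC ltr_pdivrMr// mul1r.
have L1 : L^-1 * L = 1 by rewrite mulVf.
case: {alpha beta nu} params.
- apply: admissible_gd => //; first by rewrite invr_gt0.
    by rewrite L1 ltr1n.
  exact: ltW.
- apply: admissible_gd => //; first by rewrite divr_gt0//; lra.
    by rewrite mulrAC ltr_pdivrMr; lra.
  by rewrite mulrAC ler_pdivrMr; lra.
- have sq : mu <= Num.sqrt (L * mu).
    rewrite -(ler_sqr (ltW mu_gt0 : _ \in Num.nneg)) ?nnegrE ?sqrtr_ge0//.
    by rewrite sqr_sqrtr; [nra|rewrite mulr_ge0// ltW].
  apply: admissible_gd => //; first by rewrite divr_gt0//; lra.
    by rewrite mulrAC ltr_pdivrMr; nra.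
  by rewrite mulrAC ler_pdivrMr; lra.
- apply: admissible_nag => //; rewrite -?/q ?invr_gt0 ?L1//; try lra.
- move=> b; pose q3 := Num.sqrt (3 * (L / mu) + 1).
  have k1 : 1 < L / mu by rewrite ltr_pdivlMr// mul1r.
  have q32 : q3 ^+ 2 = 3 * (L / mu) + 1 by rewrite sqr_sqrtr//; lra.
  have q3_gt2 : 2 < q3.
    have -> : 2 = Num.sqrt (2 ^+ 2) :> R by rewrite sqrtr_sqr ger0_norm.
    by rewrite /q3 ltr_sqrt; lra.
  have -> : b = (1 - 2 / q3) / (1 + 2 / q3).
    by rewrite /b -/q3; field; lra.
  apply: admissible_nag => //.
  + by rewrite divr_gt0//; lra.
  + by rewrite expr_div_n q32; field; rewrite mu_neq0; lra.
  + by rewrite divr_gt0//; lra.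
  + by rewrite mulrAC ler_pdivrMr; lra.
  + by rewrite ltr_pdivrMr; lra.
- move=> alpha /andP[al_gt0 al_le].
  have almu : alpha * mu < 1.
    by rewrite (le_lt_trans _ Lmu)// ler_pM2r.
  have almu0 : 0 < alpha * mu by rewrite mulr_gt0.
  apply: admissible_nag => //.
  + by rewrite sqrtr_gt0.
  + by rewrite sqr_sqrtr// ltW.
  + have : alpha * L <= 1 by rewrite -L1 ler_pM2r.
    lra.
  + by rewrite -[X in _ < X]sqrtr1 ltr_sqrt.
- apply: admissible_tmm => //; rewrite -/q; first by lra.
  by rewrite subKr iq2 mulrAC L1 mul1r.
- pose sm := Num.sqrt mu; pose sL := Num.sqrt L.
  have sm2 : sm ^+ 2 = mu by rewrite sqr_sqrtr// ltW.
  have sL2 : sL ^+ 2 = L by rewrite sqr_sqrtr// ltW.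
  have sm_gt0 : 0 < sm by rewrite sqrtr_gt0.
  have sL_gt0 : 0 < sL by rewrite sqrtr_gt0.
  have qE : q = sL / sm.
    by rewrite /q sqrtrM ?(ltW L_gt0)// sqrtrV// ltW.
  rewrite -/q -/sm -/sL.
  apply: admissible_hb => //.
  + by rewrite divr_gt0// exprn_gt0// addr_gt0.
  + by rewrite divr_ge0 ?ltr_pdivrMr; lra.
  + by rewrite -sm2 qE; field; rewrite !gt_eqF// addr_gt0.
  + by left; rewrite -sL2 qE; field; rewrite !gt_eqF// addr_gt0.
- rewrite -/q; pose k := L / mu; pose a := rshb_a k; rewrite -/k -/a.
  have k1 : 1 < k by rewrite ltr_pdivlMr// mul1r.
  have [aq aL] : 0 < a / q <= 1 /\ a ^+ 2 <= 1 + (1 - a / q) ^+ 2.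
    rewrite /a /rshb_a; case: ifP => [k32|_].
      rewrite -/q; pose v := Num.sqrt (2 * k - 1).
      have v2 : v ^+ 2 = 2 * k - 1 by rewrite sqr_sqrtr; lra.
      have v1 : 1 < v by rewrite -[X in X < _]sqrtr1 ltr_sqrt; lra.
      have kE : k = (v ^+ 2 + 1) / 2 by rewrite v2; field.
      have -> : q * (v - 1) / (k - 1) / q = 2 / (v + 1).
        rewrite kE; field; rewrite q_neq0/=; apply/andP; split; first by lra.
        by apply/eqP; nra.
      (* the tuning a(k) is the one for which the mode L has trace 0 *)
      have -> : (q * (v - 1) / (k - 1)) ^+ 2 = 1 + (1 - 2 / (v + 1)) ^+ 2.
        rewrite !exprMn -[q ^+ 2]/(q ^+ 2) q2 -/k exprVn kE; field.
        by apply/andP; split; [lra|apply/eqP; nra].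
      split=> //; apply/andP; split; first by rewrite divr_gt0//; lra.
      by rewrite ler_pdivrMr; lra.
    split; first by case/andP: iq => ->/= /ltW.
    by rewrite expr1n lerDl sqr_ge0.
  have /andP[aq0 aq1] := aq.
  have a_gt0 : 0 < a by rewrite -(pmulr_lgt0 _ (_ : 0 < q^-1)) ?invr_gt0//; lra.
  apply: admissible_hb => //.
  + by rewrite divr_gt0// exprn_gt0.
  + by apply/andP; split; lra.
  + by rewrite subKr expr_div_n q2; field; rewrite ?L_neq0 ?mu_neq0.
  + by right; rewrite mulrVK ?unitfE.
Qed.

(** h is the maximum of the gain of the mode mu at z = 1 and of the gain of the
    mode L at z = -1; the last part records which of the two is attained, in
    the form h p_l(sigma) = alpha sqrt(l / 2). *)
Lemma admissible_gain (R : realType) (mu L alpha beta nu : R) :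
  0 < mu < L -> admissible mu L alpha beta nu ->
  let a := mode_trace alpha beta nu in let c := mode_det alpha beta nu in
  exists h : R, [/\ 0 < h,
    forall l, mu <= l <= L -> exists v11 v12 v22,
      storage (a l) (c l) (alpha ^+ 2 * l / (2 * h ^+ 2)) v11 v12 v22
  & exists l sigma, [/\ l = mu \/ l = L, sigma ^+ 2 = 1,
      0 < 1 - a l * sigma + c l
    & h * (1 - a l * sigma + c l) = alpha * ((Num.sqrt 2)^-1 * Num.sqrt l)]].
Proof.
move=> /andP[mu_gt0 mu_L] adm a c; have [al_gt0 _ N_gt0 _] := adm.
set N := mode_at_N1 _ _ _ _ in N_gt0.
have L_gt0 : 0 < L by lra.
pose s2 := Num.sqrt (2 : R).
have s2_gt0 : 0 < s2 by rewrite sqrtr_gt0.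
have s22 : s2 ^+ 2 = 2 by rewrite sqr_sqrtr.
have [sm_gt0 sL_gt0] : 0 < Num.sqrt mu /\ 0 < Num.sqrt L by rewrite !sqrtr_gt0.
have sm2 : Num.sqrt mu ^+ 2 = mu by rewrite sqr_sqrtr// ltW.
have sL2 : Num.sqrt L ^+ 2 = L by rewrite sqr_sqrtr// ltW.
pose h1 := (s2 * Num.sqrt mu)^-1; pose h2 := alpha * (s2^-1 * Num.sqrt L) / N.
have h1_gt0 : 0 < h1 by rewrite invr_gt0 mulr_gt0.
have h2_gt0 : 0 < h2 by rewrite divr_gt0// !mulr_gt0// invr_gt0.
exists (Num.max h1 h2); set h := Num.max h1 h2.
have h_gt0 : 0 < h by rewrite lt_max h1_gt0.
have h2_ge (x : R) : 0 < x -> x <= h -> x ^+ 2 <= h ^+ 2.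
  by move=> x0 xh; rewrite ler_sqr ?nnegrE ?(ltW x0) ?(ltW h_gt0).
split=> // [l l_itv|].
  have l_gt0 : 0 < l by case/andP: l_itv; lra.
  have hh : 0 < 2 * h ^+ 2 by rewrite mulr_gt0// exprn_gt0.
  apply: (admissible_storage mu_gt0 adm) => //.
  - by rewrite divr_ge0 ?(ltW hh)// mulr_ge0 ?sqr_ge0// ltW.
  - rewrite ler_pdivrMr// -[leLHS]mulr1 -[leRHS]mulrA ler_pM2l;
    last by rewrite mulr_gt0// exprn_gt0.
    have := h2_ge h1 h1_gt0; rewrite le_max lexx => /(_ isT).
    rewrite -(ler_pM2l (_ : 0 < 2 * mu)) ?mulr_gt0//.
    have -> : 2 * mu * h1 ^+ 2 = 1 by
      rewrite /h1 exprVn exprMn s22 sm2 mulfV// mulf_neq0 ?gt_eqF.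
    by rewrite [mu * _]mulrCA mulrA.
  - rewrite ler_pdivrMr//.
    have := h2_ge h2 h2_gt0; rewrite le_max lexx orbT => /(_ isT).
    rewrite -(ler_pM2l (_ : 0 < l / L * N ^+ 2 *
      2)) ?mulr_gt0 ?invr_gt0 ?exprn_gt0//.
    have -> : l / L * N ^+ 2 * 2 * h2 ^+ 2 = alpha ^+ 2 * l.
      rewrite /h2 !exprMn !exprVn s22 sL2; field.
      by rewrite !gt_eqF.
    by rewrite -!mulrA.
have [h12|h21] := leP h2 h1.
  exists mu, 1; rewrite expr1n; have -> : 1 - a mu * 1 + c mu = alpha * mu.
    by rewrite /a /c /mode_trace /mode_det; ring.
  split=> //; [by left|by rewrite mulr_gt0|].
  have -> : alpha * mu = alpha * Num.sqrt mu ^+ 2 by rewrite sm2.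
  rewrite /h max_l// /h1 -/s2; field.
  by rewrite !gt_eqF.
exists L, (-1); rewrite sqrrN expr1n; have -> : 1 - a L * -1 + c L = N.
  by rewrite /a /c /mode_trace /mode_det /N /mode_at_N1; ring.
split=> //; first by right.
by rewrite /h max_r ?(ltW h21)// /h2 -/s2; field; rewrite !gt_eqF.
Qed.


(** * Complex norms, spectra and orthogonal diagonalization *)

(** [eigenvalue] speaks of row vectors, while states are columns. *)
Lemma eigenvalue_colP (F : fieldType) n (M : 'M[F]_n) (a : F) :
  eigenvalue M a <-> exists2 v : 'cV_n, v != 0 & M *m v = a *: v.
Proof.
have -> : eigenvalue M a = eigenvalue M^T a.
  rewrite /eigenvalue /eigenspace !kermx_eq0 !row_free_unit.
  by rewrite -[in RHS]unitmx_tr linearB/= trmxK tr_scalar_mx.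
split=> [/eigenvalueP[v vM v0]|[v v0 Mv]].
  exists v^T; first by rewrite trmx_eq0.
  by rewrite -[M]trmxK -trmx_mul vM linearZ.
by apply/eigenvalueP; exists v^T; rewrite ?trmx_eq0// -trmx_mul Mv linearZ.
Qed.

Section Eigendecomposition.
Variables (F : fieldType) (d : nat) (Q U : 'M[F]_d) (lam : 'rV[F]_d).
Hypothesis UU : U^T *m U = 1%:M.
Hypothesis QE : Q = U *m diag_mx lam *m U^T.

Lemma diagonalized_eigenvector i : let u := U *m (delta_mx i ord0 : 'cV_d) in
  Q *m u = lam ord0 i *: u.
Proof.
rewrite /= QE -!mulmxA (mulmxA U^T) UU mul1mx mul_diag_mx scalemxAr.
congr (_ *m _); apply/matrixP => j k; rewrite !mxE.
by have [->|] := eqVneq j i; rewrite ?mulr0 ?andbF.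
Qed.

Lemma eigenvalue_diagonalized l : eigenvalue Q l <-> exists i, lam ord0 i = l.
Proof.
rewrite eigenvalue_colP; split=> [[v v0 Qv]|[i <-]].
  have Dy : diag_mx lam *m (U^T *m v) = l *: (U^T *m v).
    by rewrite scalemxAr -Qv QE !mulmxA UU mul1mx.
  have y0 : U^T *m v != 0.
    apply: contra v0 => /eqP y0.
    by rewrite -[v]mul1mx -(mulmx1C UU) -mulmxA y0 mulmx0.
  have /cV0Pn[i yi] := y0.
  exists i; apply: (mulIf yi).
  by move/matrixP/(_ i ord0): Dy; rewrite mul_diag_mx !mxE.
exists (U *m (delta_mx i ord0 : 'cV_d)); last exact: diagonalized_eigenvector.
apply/eqP => /(congr1 (mulmx U^T)); rewrite mulmxA UU mul1mx mulmx0.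
by move/matrixP/(_ i ord0)/eqP; rewrite !mxE !eqxx oner_eq0.
Qed.

End Eigendecomposition.

Section ComplexNorms.
Variable R : realType.
Implicit Types z : R[i].
Local Notation normc := Normc.normc.

Lemma sqr_normcE z : normc z ^+ 2 = complex.Re z ^+ 2 + complex.Im z ^+ 2.
Proof. by case: z => x y /=; rewrite sqr_sqrtr// addr_ge0// sqr_ge0. Qed.

Lemma normc_ge0 z : 0 <= normc z.
Proof. by case: z => x y; rewrite sqrtr_ge0. Qed.

Lemma normc_real (x : R) : normc x%:C%C = `|x|.
Proof. by rewrite /= expr0n addr0 sqrtr_sqr. Qed.

Lemma ler_normc_sum (I : Type) (s : seq I) (F : I -> R[i]) :
  normc (\sum_(i <- s) F i) <= \sum_(i <- s) normc (F i).
Proof.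
elim/big_rec2: _ => [|i x y _ xy]; first by rewrite Normc.normc0.
by rewrite (le_trans (le_normcD _ _))// lerD2l.
Qed.

Lemma sqr_cnorm2 n (v : 'cV[R[i]]_n) :
  cnorm2 v ^+ 2 = \sum_i normc (v i ord0) ^+ 2.
Proof. by rewrite sqr_sqrtr// sumr_ge0// => i _; rewrite sqr_ge0. Qed.

Lemma cnorm2_ge0 n (v : 'cV[R[i]]_n) : 0 <= cnorm2 v.
Proof. exact: sqrtr_ge0. Qed.

Lemma cnorm2Z n a (v : 'cV[R[i]]_n) : cnorm2 (a *: v) = normc a * cnorm2 v.
Proof.
apply: (@pexpIrn _ 2) => //; rewrite ?nnegrE ?mulr_ge0 ?cnorm2_ge0 ?normc_ge0//.
rewrite exprMn !sqr_cnorm2 mulr_sumr; apply: eq_bigr => i _.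
by rewrite mxE Normc.normcM exprMn.
Qed.

Lemma cnorm2_eq0 n (v : 'cV[R[i]]_n) : cnorm2 v = 0 -> v = 0.
Proof.
move=> v0; have /eqP := sqr_cnorm2 v; rewrite v0 expr0n/= eq_sym.
rewrite psumr_eq0 => [/allP vi0|i _]; last exact: sqr_ge0.
apply/matrixP => i j; rewrite ord1 mxE; apply: Normc.eq0_normc.
by apply/eqP; have := vi0 i; rewrite sqrf_eq0 mem_index_enum => /(_ isT).
Qed.

Lemma sqr_cnorm2_delta n (i : 'I_n) (a : R[i]) :
  cnorm2 (a *: delta_mx i ord0) ^+ 2 = normc a ^+ 2.
Proof.
rewrite sqr_cnorm2 (bigD1 i)//= !mxE !eqxx mulr1 big1 ?addr0// => j ji.
by rewrite !mxE (negPf ji) mulr0 Normc.normc0 expr0n.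
Qed.

Lemma orthogonal_sum_sqr n (O : 'M[R]_n) (v : 'cV[R]_n) : O^T *m O = 1%:M ->
  \sum_i (O *m v) i ord0 ^+ 2 = \sum_i v i ord0 ^+ 2.
Proof.
have dot (w : 'cV[R]_n) : \sum_i w i ord0 ^+ 2 = (w^T *m w) ord0 ord0.
  by rewrite mxE; apply: eq_bigr => i _; rewrite mxE expr2.
by move=> OO; rewrite !dot trmx_mul mulmxA -(mulmxA _ _ O) OO mulmx1.
Qed.

Lemma Re_complexify_mul m n (M : 'M[R]_(m, n)) (v : 'cV[R[i]]_n) i :
  complex.Re ((complexify M *m v) i ord0) =
    (M *m map_mx (@complex.Re R) v) i ord0.
Proof.
rewrite !mxE; elim/big_rec2: _ => [|j x y _ xy] //.
by rewrite !mxE -xy; case: (v j ord0) y {xy} => a b [c d]/=;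
  rewrite mul0r subr0.
Qed.

Lemma Im_complexify_mul m n (M : 'M[R]_(m, n)) (v : 'cV[R[i]]_n) i :
  complex.Im ((complexify M *m v) i ord0) =
    (M *m map_mx (@complex.Im R) v) i ord0.
Proof.
rewrite !mxE; elim/big_rec2: _ => [|j x y _ xy] //.
by rewrite !mxE -xy; case: (v j ord0) y {xy} => a b [c d]/=;
  rewrite mul0r addr0.
Qed.

(** A real matrix acts separately on the real and imaginary parts. *)
Lemma cnorm2_orthogonal n (O : 'M[R]_n) (v : 'cV[R[i]]_n) : O^T *m O = 1%:M ->
  cnorm2 (complexify O *m v) = cnorm2 v.
Proof.
move=> OO; rewrite /cnorm2; congr Num.sqrt.
under eq_bigr do rewrite sqr_normcE Re_complexify_mul Im_complexify_mul.
under [RHS]eq_bigr do rewrite sqr_normcE.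
rewrite !big_split/= !orthogonal_sum_sqr//.
by congr (_ + _); apply: eq_bigr => i _; rewrite mxE.
Qed.

Section SpectralNorm.
Variables (m n : nat) (M : 'M[R[i]]_(m, n)).
Let images := [set cnorm2 (M *m v) | v in [set v : 'cV[R[i]]_n | cnorm2 v <=
  1]].

(* sup is a least upper bound only for bounded sets. *)
Let images_bounded : has_ubound images.
Proof.
exists (Num.sqrt (\sum_i (\sum_j normc (M i j)) ^+ 2)) => _ [v /= v1 <-].
rewrite ler_sqrt ?sumr_ge0// => [|i _]; last exact: sqr_ge0.
apply: ler_sum => i _; rewrite ler_sqr ?nnegrE ?normc_ge0//; last first.
  by rewrite sumr_ge0// => j _; exact: normc_ge0.
rewrite mxE (le_trans (ler_normc_sum _ _))//; apply: ler_sum => j _.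
rewrite Normc.normcM ler_piMr ?normc_ge0//; apply: le_trans v1.
rewrite -ler_sqr ?nnegrE ?cnorm2_ge0 ?normc_ge0//.
rewrite sqr_cnorm2 (bigD1 j)//= lerDl sumr_ge0// => k _; exact: sqr_ge0.
Qed.

Lemma spectral_norm_ub v : cnorm2 (M *m v) <= spectral_norm M * cnorm2 v.
Proof.
have [v0|v_neq0] := eqVneq (cnorm2 v) 0.
  rewrite v0 mulr0; rewrite (cnorm2_eq0 v0) mulmx0.
  have := @cnorm2Z m 0 0; rewrite scale0r Normc.normc0 mul0r => ->.
  exact: lexx.
have v_gt0 : 0 < cnorm2 v by rewrite lt_neqAle eq_sym v_neq0 cnorm2_ge0.
rewrite -ler_pdivrMr//; apply: ub_le_sup => //.
have nv : normc (cnorm2 v)^-1%:C%C = (cnorm2 v)^-1.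
  by rewrite normc_real ger0_norm// invr_ge0 cnorm2_ge0.
exists ((cnorm2 v)^-1%:C%C *: v); rewrite /= ?cnorm2Z ?nv ?mulVf//.
by rewrite -scalemxAr cnorm2Z nv mulrC.
Qed.

Lemma spectral_norm_le (h : R) :
  0 <= h -> (forall v, cnorm2 (M *m v) <= h * cnorm2 v) -> spectral_norm M <= h.
Proof.
move=> h0 Mh; apply: ge_sup => [|_ [v /= v1 <-]].
  exists (cnorm2 (M *m 0)), 0 => //=.
  have := @cnorm2Z n 0 0; rewrite scale0r Normc.normc0 mul0r => ->.
  exact: ler01.
by rewrite (le_trans (Mh v))// ler_piMr.
Qed.

Lemma spectral_norm_ge v : cnorm2 v = 1 -> cnorm2 (M *m v) <= spectral_norm M.
Proof. by move=> v1; have := spectral_norm_ub v; rewrite v1 mulr1. Qed.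

End SpectralNorm.

Section SpectralRadius.
Variables (n : nat) (M : 'M[R[i]]_n).

Lemma spectral_radius_le (r : R) :
  0 <= r -> (forall z, eigenvalue M z -> normc z <= r) ->
    spectral_radius M <= r.
Proof.
move=> r0 Mr; rewrite /spectral_radius; set E := [set normc _ | _ in _].
have [->|/set0P E0] := eqVneq E set0; first by rewrite sup0.
by apply: ge_sup => // _ [z /= Mz <-]; exact: Mr.
Qed.

Lemma spectral_radius_ge z : eigenvalue M z -> normc z <= spectral_radius M.
Proof.
move=> Mz; apply: ub_le_sup; last by exists z.
have [rs pE] := closed_field_poly_normal (char_poly M).
exists (\sum_(x <- rs) normc x) => _ [x /= + <-].
rewrite eigenvalue_root_char pE rootZ; last first.
  by rewrite (monicP (char_poly_monic M)) oner_eq0.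
rewrite root_prod_XsubC; elim: rs {pE} => [//|y rs IH].
rewrite inE big_cons => /predU1P[->|/IH xrs].
  by rewrite lerDl sumr_ge0// => j _; exact: normc_ge0.
by rewrite (le_trans xrs)// lerDr normc_ge0.
Qed.

End SpectralRadius.
End ComplexNorms.

(** * Modal decomposition in the frequency domain *)

Section StorageFrequency.
Variable R : realType.
Local Notation normc := Normc.normc.

Definition mode_poly (a c : R) (z : R[i]) : R[i] :=
  z ^+ 2 - a%:C%C * z + c%:C%C.

(** The dissipation inequality on the signal 1, z, z^2: its real and imaginary
    parts are added, and V, taken as a Hermitian form, is homogeneous:
    V (z^2, z) = |z|^2 V (z, 1). *)
Lemma storage_frequency (a c e v11 v12 v22 : R) z : storage a c e v11 v12 v22 ->
  e * normc z ^+ 2 + (normc z ^+ 2 - 1) *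
    (qform v11 v12 v22 (complex.Re z) 1 + qform v11 v12 v22 (complex.Im z) 0)
  <= normc (mode_poly a c z) ^+ 2.
Proof.
case: z => x y [_ diss]; rewrite !sqr_normcE /=.
have := lerD (diss (x ^+ 2 - y ^+ 2) x 1) (diss (2 * x * y) y 0).
rewrite -subr_ge0 => H; rewrite -subr_ge0; apply: le_trans H _.
by rewrite le_eqVlt; apply/orP; left; apply/eqP; rewrite /qform; ring.
Qed.

Lemma storage_outside_disk (a c e v11 v12 v22 : R)
  z : storage a c e v11 v12 v22 ->
  1 <= normc z -> e * normc z ^+ 2 <= normc (mode_poly a c z) ^+ 2.
Proof.
move=> st z1; apply: le_trans (storage_frequency z st); rewrite lerDl.
apply: mulr_ge0; last by rewrite addr_ge0 ?(proj1 st).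
by rewrite subr_ge0 -[X in X <= _](expr1n _ 2) ler_sqr ?nnegrE ?normc_ge0.
Qed.

(** The term V (z, 1) of [storage_frequency] is bounded on the disk and has the
    factor |z|^2 - 1, so a constant factor theta < 1 absorbs it near the
    circle. *)
Lemma storage_near_circle (a c e v11 v12 v22 theta : R) :
  storage a c e v11 v12 v22 -> 0 < e -> 0 < theta < 1 ->
  exists2 delta : R, 0 < delta & forall z, 1 - delta <= normc z ^+ 2 ->
    theta * e * normc z ^+ 2 <= normc (mode_poly a c z) ^+ 2.
Proof.
move=> st e0 /andP[t0 t1].
pose C := `|v11| + 2 * `|v12| + `|v22| + 1.
have [n1 n2 n3] : [/\ 0 <= `|v11|, 0 <= `|v12| & 0 <= `|v22|] by [].
have C0 : 0 < C by rewrite /C; lra.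
pose s := (1 - theta) * e.
have s0 : 0 < s by rewrite mulr_gt0// subr_gt0.
exists (s / (C + s)) => [|z]; first by rewrite divr_gt0// addr_gt0.
set delta := s / _ => z_ge.
have dE : s * (1 - delta) = C * delta.
  by rewrite /delta; field; rewrite gt_eqF// addr_gt0.
have [z1|z1] := leP 1 (normc z).
  apply: le_trans (storage_outside_disk st z1);
    rewrite -mulrA ler_piMl ?(ltW t1)//.
  by rewrite mulr_ge0 ?sqr_ge0// ltW.
have z2 : normc z ^+ 2 <= 1.
  by rewrite -[X in _ <= X](expr1n _ 2) ler_sqr ?nnegrE ?normc_ge0// ltW.
have := storage_frequency z st.
set W := qform _ _ _ _ 1 + _ => freq.
have WC : W <= C.
  rewrite /W /C; move: z2; rewrite sqr_normcE.
  case: z {z_ge z1 W freq} => x y /= xy.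
  have x1 : `|x| <= 1 by rewrite ler_norml; apply/andP; split; nra.
  have -> : qform v11 v12 v22 x 1 + qform v11 v12 v22 y 0 =
    v11 * (x ^+ 2 + y ^+ 2) + 2 * (v12 * x) + v22 by rewrite /qform; ring.
  have -> : `|v11| + 2 * `|v12| + `|v22| + 1 =
    `|v11| * 1 + 2 * (`|v12| * 1) + (`|v22| + 1) by ring.
  rewrite !lerD//.
  - by rewrite (le_trans (ler_norm _))// normrM ler_wpM2l// ger0_norm//
    addr_ge0// sqr_ge0.
  - by rewrite ler_pM2l// (le_trans (ler_norm _))// normrM ler_wpM2l//.
  - by rewrite (le_trans (ler_norm _))// lerDl.
move: (normc z ^+ 2) z_ge z2 freq => q z_ge z2 freq.
apply: le_trans freq.
have W0 : (1 - q) * W <= delta * C.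
  apply: (@le_trans _ _ ((1 - q) * C)); first by rewrite ler_wpM2l// subr_ge0.
  by rewrite ler_wpM2r ?(ltW C0)//; lra.
have : s * (1 - delta) <= s * q by rewrite ler_pM2l.
by rewrite dE /s; nra.
Qed.
End StorageFrequency.

Lemma finite_uniform (R : realType) (I : finType) (P : I -> R -> Prop) :
  (forall i x y, x <= y -> P i y -> P i x) ->
  (forall i, exists2 x, 0 < x & P i x) -> exists2 x, 0 < x & forall i, P i x.
Proof.
move=> Pmon Pex; have /choice[f fP] : forall i, exists x, 0 < x /\ P i x.
  by move=> i; have [x ? ?] := Pex i; exists x.
exists (\big[Order.min/1]_i f i).
  by elim/big_ind: _ => // [x y x0 y0|i _]; [rewrite lt_min x0|case: (fP i)].
by move=> i; apply: Pmon (proj2 (fP i)); apply: bigmin_le_cond.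
Qed.

Section Modal.
Variables (R : realType) (d : nat) (Q U : 'M[R]_d) (lam : 'rV[R]_d).
Variables (alpha beta nu : R).
Hypothesis UU : U^T *m U = 1%:M.
Hypothesis QE : Q = U *m diag_mx lam *m U^T.
Local Notation normc := Normc.normc.
Local Notation "M ^C" := (complexify M) : ring_scope.
Let A := gmm_A alpha beta nu Q.
Let B := gmm_B d alpha.
Let T := gmm_T U lam.

Definition gmm_mode_poly (i : 'I_d) (z : R[i]) : R[i] :=
  mode_poly (mode_trace alpha beta nu (lam ord0 i)) (mode_det alpha beta nu
    (lam ord0 i)) z.

Let UU' : U *m U^T = 1%:M. Proof. exact: mulmx1C. Qed.
Let UUC : (U^T)^C *m U^C = 1%:M. Proof. by rewrite -map_mxM UU map_mx1. Qed.
Let UUC' : U^C *m (U^T)^C = 1%:M. Proof. by rewrite -map_mxM UU' map_mx1. Qed.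
Let UTT : (U^T)^T *m U^T = 1%:M. Proof. by rewrite trmxK. Qed.

(** The state equation of the method, in block form for (x_k, x_(k-1)), with an
    input u of frequency z. Read with u = Delta T w it is the eigenvalue
    equation of the perturbed matrix; with u arbitrary it defines the transfer
    function. *)
Lemma modal_equation z (w1 w2 u : 'cV[R[i]]_d) :
  A^C *m col_mx w1 w2 + B^C *m u = z *: col_mx w1 w2 <->
  w1 = z *: w2 /\ forall i, gmm_mode_poly i z * ((U^T)^C *m w2) i ord0 =
                            - (alpha%:C%C) * ((U^T)^C *m u) i ord0.
Proof.
have QUT : (U^T)^C *m Q^C = diag_mx (map_mx (real_complex R) lam) *m (U^T)^C.
  by rewrite QE /complexify !map_mxM map_diag_mx !mulmxA -map_mxM UU map_mx1
    mul1mx.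
rewrite /A /B /gmm_A /gmm_B /complexify map_block_mx map_col_mx mul_block_col
  mul_col_mx.
rewrite scale_col_mx add_col_mx map_mx0 !map_mx1 !mul0mx mul1mx !addr0.
pose E := (map_mx (real_complex R) ((1 + beta)%:M - (alpha * (1 +
  nu)) *: Q)) *m w1 + (map_mx (real_complex R)
  (- beta%:M + (alpha * nu) *: Q)) *m w2 + (map_mx (real_complex R)
  (- alpha%:M)) *m u.
have EU i : w1 = z *: w2 -> ((U^T)^C *m (z *: w1 - E)) i ord0 =
   gmm_mode_poly i z * ((U^T)^C *m w2) i ord0 + alpha%:C%C * ((U^T)^C *m u)
     i ord0.
  rewrite /E => ->.
  rewrite !(map_mxB, map_mxD, map_mxN, map_mxZ, map_scalar_mx) !(mulmxDl,
    mulmxBl, mulNmx, mul_scalar_mx) -!scalemxAl -!scalemxAr.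
  rewrite !(mulmxDr, mulmxBr, mulmxN) -!scalemxAr !mulmxA QUT -!mulmxA
    mul_diag_mx.
  move: ((U^T)^C *m w2) ((U^T)^C *m u) => y v.
  rewrite !mxE /gmm_mode_poly /mode_poly /mode_trace /mode_det.
  rewrite !(rmorphD, rmorphB, rmorphM, rmorph1, rmorphN)/=.
  by ring.
split.
  move/eq_col_mx => [E1 E2]; split=> // i.
  apply/eqP; rewrite mulNr -addr_eq0 -EU//.
  by rewrite /E E1 subrr mulmx0 mxE.
move=> [w12 modes]; congr col_mx => //.
apply/eqP; rewrite eq_sym -subr_eq0 -/E.
rewrite -[X in X == 0]mul1mx -UUC' -mulmxA.
suff -> : (U^T)^C *m (z *: w1 - E) = 0 by rewrite mulmx0.
by apply/matrixP => i j; rewrite ord1 EU// modes mulNr addNr mxE.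
Qed.

Lemma modal_output (w1 w2 : 'cV[R[i]]_d) i :
  (T^C *m col_mx w1 w2) i ord0 =
  ((Num.sqrt 2)^-1 * Num.sqrt (lam ord0 i))%:C%C * ((U^T)^C *m w1) i ord0.
Proof.
rewrite /T /gmm_T /complexify map_row_mx mul_row_col map_mx0 mul0mx addr0.
rewrite map_mxZ map_mxM map_diag_mx -scalemxAl -mulmxA mul_diag_mx !mxE.
by rewrite rmorphM/= -mulrA.
Qed.

Hypothesis alpha_gt0 : 0 < alpha.
Hypothesis lam_gt0 : forall i, 0 < lam ord0 i.

(** The modes being orthogonal, a bound for each of them is a bound for the
    whole response. *)
Lemma modal_gain z (w1 w2 u : 'cV[R[i]]_d) (G : R) :
  (forall i, alpha ^+ 2 * lam ord0 i / 2 * normc z ^+ 2 <=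
    G * normc (gmm_mode_poly i z) ^+ 2) ->
  A^C *m col_mx w1 w2 + B^C *m u = z *: col_mx w1 w2 ->
  cnorm2 (T^C *m col_mx w1 w2) ^+ 2 <= G * cnorm2 u ^+ 2.
Proof.
move=> Gz /modal_equation[w12 modes].
rewrite -(cnorm2_orthogonal u UTT) !sqr_cnorm2 mulr_sumr.
apply: ler_sum => i _; rewrite modal_output Normc.normcM normc_real.
rewrite w12 -scalemxAr mxE Normc.normcM !exprMn.
rewrite real_normK ?num_real// exprMn exprVn !sqr_sqrtr ?ler0n//;
  last exact: ltW.
have a2 : 0 < alpha ^+ 2 by rewrite exprn_gt0.
rewrite -(ler_pM2l a2).
have := congr1 (fun x => normc x ^+ 2) (modes i).
rewrite /= !Normc.normcM normcN normc_real !exprMn real_normK ?num_real// => E.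
rewrite [leRHS]mulrCA -E.
rewrite [leRHS]mulrA; apply: le_trans (ler_wpM2r (sqr_ge0 _) (Gz i)).
by rewrite le_eqVlt; apply/orP; left; apply/eqP; ring.
Qed.

Lemma modal_kernel z (w1 w2 : 'cV[R[i]]_d) :
  (forall i, gmm_mode_poly i z != 0) ->
  A^C *m col_mx w1 w2 = z *: col_mx w1 w2 -> col_mx w1 w2 = 0.
Proof.
move=> pz Aw; have : A^C *m col_mx w1 w2 + B^C *m 0 = z *: col_mx w1 w2.
  by rewrite mulmx0 addr0.
move=> /modal_equation[-> modes]; suff -> : w2 = 0 by rewrite scaler0 col_mx0.
rewrite -[w2]mul1mx -UUC' -mulmxA.
suff -> : (U^T)^C *m w2 = 0 by rewrite mulmx0.
apply/matrixP => i j; rewrite ord1; have := modes i.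
rewrite mulmx0 [in RHS]mxE mulr0 => /eqP; rewrite mulf_eq0 (negPf (pz i))/=.
by move/eqP => ->; rewrite mxE.
Qed.

(** The input along the i-th eigenvector, of frequency z, only excites the i-th
    mode, and b is its response. *)
Lemma modal_excitation i z (b : R[i]) : gmm_mode_poly i z * b = - alpha%:C%C ->
  let v := U^C *m (delta_mx i ord0 : 'cV_d) in
  A^C *m col_mx (z * b *: v) (b *: v) + B^C *m v =
    z *: col_mx (z * b *: v) (b *: v).
Proof.
move=> pb v; apply/modal_equation; split; first by rewrite scalerA.
move=> j; rewrite -scalemxAr /v mulmxA UUC mul1mx !mxE.
have [->|] := eqVneq j i; last by rewrite !mulr0.
by rewrite mulr1 pb mulr1.
Qed.

End Modal.

(** * The H-infinity norm and the stability radii *)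

Section FrequencyDomain.
Variables (R : realType) (d : nat) (Q U : 'M[R]_d) (lam : 'rV[R]_d).
Variables (alpha beta nu h : R).
Hypothesis UU : U^T *m U = 1%:M.
Hypothesis QE : Q = U *m diag_mx lam *m U^T.
Hypothesis alpha_gt0 : 0 < alpha.
Hypothesis lam_gt0 : forall i, 0 < lam ord0 i.
Hypothesis h_gt0 : 0 < h.
Let e i := alpha ^+ 2 * lam ord0 i / (2 * h ^+ 2).
Hypothesis certified : forall i, exists v11 v12 v22,
  storage (mode_trace alpha beta nu (lam ord0 i))
          (mode_det alpha beta nu (lam ord0 i)) (e i) v11 v12 v22.
Local Notation normc := Normc.normc.
Local Notation "M ^C" := (complexify M) : ring_scope.
Let A := gmm_A alpha beta nu Q.
Let B := gmm_B d alpha.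
Let T := gmm_T U lam.
Let p i z := gmm_mode_poly lam alpha beta nu i z.

Let e_gt0 i : 0 < e i.
Proof. by rewrite divr_gt0// mulr_gt0// exprn_gt0. Qed.

Let eE i : alpha ^+ 2 * lam ord0 i / 2 = h ^+ 2 * e i.
Proof. by rewrite /e; field; rewrite gt_eqF. Qed.

(** A small gain argument: if z is an eigenvalue with output y = T w, then the
    input of the unperturbed system is Delta y, and
    |y|^2 <= G |Delta y|^2 <= G eps^2 |y|^2 for a gain G close to h^2. Taking
    G = h^2 / theta with (eps h)^2 < theta < 1 keeps G eps^2 < 1, and
    G is still a gain for |z| slightly below 1; how far below does not depend on
    Delta, which makes eta uniform in Delta, as the supremum in the stability
    radius requires. *)
Lemma perturbed_eigenvalue_bound (eps : R) : 0 <= eps -> eps * h < 1 ->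
  exists2 eta : R, 0 <= eta < 1 & forall Delta : 'M[R[i]]_d,
    spectral_norm Delta <= eps ->
    spectral_radius (A^C + B^C *m Delta *m T^C) <= eta.
Proof.
move=> eps0 eps_h; pose x := (eps * h) ^+ 2.
have x0 : 0 <= x by exact: sqr_ge0.
have x1 : x < 1 by rewrite expr_lt1// mulr_ge0// ltW.
pose theta := (1 + x) / 2.
have t01 : 0 < theta < 1 by rewrite /theta; lra.
have t0 : 0 < theta by case/andP: t01.
have xt : x < theta by rewrite /theta; lra.
have [delta delta0 near] : exists2 delta : R, 0 < delta & forall i z,
    1 - delta <= normc z ^+ 2 ->
    theta * e i * normc z ^+ 2 <= normc (p i z) ^+ 2.
  apply: finite_uniform => [i u v uv Pv z uz|i].
    by apply: Pv; apply: le_trans uz; rewrite lerD2l lerN2.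
  have [v11 [v12 [v22 st]]] := certified i.
  exact: (storage_near_circle st (e_gt0 i) t01).
pose m := Num.max 0 (1 - delta).
have m0 : 0 <= m by rewrite /m le_max lexx.
have m1 : m < 1 by rewrite /m gt_max ltr01/=; lra.
exists (Num.sqrt m); first by rewrite sqrtr_ge0 -[X in _ < X]sqrtr1 ltr_sqrt.
move=> Delta Deps; apply: spectral_radius_le; first exact: sqrtr_ge0.
move=> z /eigenvalue_colP[w w_neq0 Mw]; rewrite leNgt; apply/negP => z_gt.
have z2 : m < normc z ^+ 2.
  by rewrite -[m]sqr_sqrtr// ltr_sqr ?nnegrE ?sqrtr_ge0 ?normc_ge0.
have z_ge : 1 - delta <= normc z ^+ 2.
  by apply: le_trans (ltW z2); rewrite /m le_max lexx orbT.
have pz i : p i z != 0.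
  apply/eqP => p0; have := near i _ z_ge.
  rewrite p0 Normc.normc0 expr0n/= leNgt => /negP; apply.
  by apply: mulr_gt0 (mulr_gt0 t0 (e_gt0 i)) (le_lt_trans m0 z2).
move: Mw; rewrite mulmxDl -!mulmxA -[w]vsubmxK; set w1 := usubmx w;
  set w2 := dsubmx w.
set y := T^C *m _ => Aw.
have y0 : y = 0.
  apply: cnorm2_eq0; apply/eqP; rewrite -sqrf_eq0 eq_le sqr_ge0 andbT.
  have gain : cnorm2 y ^+ 2 <= h ^+ 2 / theta * cnorm2 (Delta *m y) ^+ 2.
    apply: (modal_gain UU QE alpha_gt0 lam_gt0 _ Aw) => i.
    rewrite eE mulrAC -mulrA [leRHS]mulrAC ler_pdivlMr//.
    rewrite (_ : _ * theta = h ^+ 2 * (theta * e i * normc z ^+ 2));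
      last by ring.
    by rewrite ler_wpM2l ?sqr_ge0// near.
  have Dy : cnorm2 (Delta *m y) ^+ 2 <= eps ^+ 2 * cnorm2 y ^+ 2.
    rewrite -exprMn ler_sqr ?nnegrE ?mulr_ge0 ?cnorm2_ge0//.
    by rewrite (le_trans (spectral_norm_ub _ _))// ler_wpM2r// cnorm2_ge0.
  have : cnorm2 y ^+ 2 <= x / theta * cnorm2 y ^+ 2.
    apply: (le_trans gain); rewrite /x exprMn.
    have ht : 0 <= h ^+ 2 / theta by rewrite divr_ge0 ?sqr_ge0// ltW.
    apply: le_trans (ler_wpM2l ht Dy) _.
    by rewrite le_eqVlt; apply/orP; left; apply/eqP; field; rewrite gt_eqF.
  have : x / theta < 1 by rewrite ltr_pdivrMr// mul1r.
  move: (x / theta) (cnorm2 y ^+ 2) => s q s1 qs.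
  have : 0 <= (s - 1) * q by lra.
  by rewrite nmulr_rge0// subr_lt0.
move: Aw; rewrite y0 !mulmx0 addr0 => /(modal_kernel UU QE pz) w0.
by move: w_neq0; rewrite -[w]vsubmxK w0 eqxx.
Qed.

Lemma gmm_A_stable : spectral_radius A^C < 1.
Proof.
have [|eta /andP[_ eta1] bound] := perturbed_eigenvalue_bound (lexx 0).
  by rewrite mul0r.
have := bound 0; rewrite mulmx0 mul0mx addr0 => /(_ _)/le_lt_trans; apply => //.
by apply: spectral_norm_le => // v; rewrite mul0mx mul0r -(scale0r 0)
  cnorm2Z Normc.normc0 mul0r.
Qed.

Lemma resolvent_unit z : normc z = 1 -> z%:M - A^C \in unitmx.
Proof.
move=> z1; rewrite -row_free_unit; apply: contraT => notfree.
have : eigenvalue A^C z.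
  rewrite /eigenvalue /eigenspace kermx_eq0; apply: contra notfree.
  by rewrite !row_free_unit -opprB -scaleN1r unitmxZ ?unitrN1.
by move/spectral_radius_ge; rewrite z1 leNgt gmm_A_stable.
Qed.

Lemma resolventP z (u v : 'cV[R[i]]_(d + d)) : normc z = 1 ->
  A^C *m u + v = z *: u <-> u = invmx (z%:M - A^C) *m v.
Proof.
move=> z1; have unit := resolvent_unit z1.
have -> : (A^C *m u + v = z *: u) <-> ((z%:M - A^C) *m u = v).
  by rewrite mulmxBl mul_scalar_mx; split=> [<-|<-];
    rewrite addrC ?addKr ?subrK// addrK.
by split=> [<-|->]; rewrite ?mulKmx ?mulKVmx.
Qed.

Lemma transfer_norm_le z : normc z = 1 -> spectral_norm (transfer A B T z) <= h.
Proof.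
move=> z1; apply: spectral_norm_le => [|v]; first exact: ltW.
rewrite -ler_sqr ?nnegrE ?mulr_ge0 ?cnorm2_ge0 ?(ltW h_gt0)//.
rewrite exprMn /transfer -!mulmxA; set w := invmx _ *m _.
have : A^C *m w + B^C *m v = z *: w by apply/(resolventP _ _ z1).
rewrite -[w]vsubmxK; apply: (modal_gain UU QE) => // i.
rewrite eE -mulrA ler_wpM2l ?sqr_ge0//.
have [v11 [v12 [v22 st]]] := certified i.
by apply: (storage_outside_disk st); rewrite z1.
Qed.

(** The mode i0 attains the gain h at the real frequency sigma. *)
Section Critical.
Variables (i0 : 'I_d) (sigma : R).
Hypothesis sigma2 : sigma ^+ 2 = 1.
Let P := 1 - mode_trace alpha beta nu
  (lam ord0 i0) * sigma + mode_det alpha beta nu (lam ord0 i0).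
Hypothesis P_gt0 : 0 < P.
Let kap := (Num.sqrt 2)^-1 * Num.sqrt (lam ord0 i0).
Hypothesis critical : h * P = alpha * kap.
Let v := U^C *m (delta_mx i0 ord0 : 'cV[R[i]]_d).
Let b : R := - alpha / P.
Let w := col_mx (sigma%:C%C * b%:C%C *: v) (b%:C%C *: v).

Let sigma_norm : `|sigma| = 1.
Proof. by apply/eqP; rewrite -sqrp_eq1// real_normK ?num_real// sigma2. Qed.

Let state : A^C *m w + B^C *m v = sigma%:C%C *: w.
Proof.
apply: (modal_excitation UU QE).
rewrite /gmm_mode_poly /mode_poly -rmorphXn/= -!(rmorphM, rmorphB,
  rmorphD) -rmorphN/=.
by congr (_%:C)%C; rewrite sigma2 -/P /b; field; rewrite gt_eqF.
Qed.

Let output : T^C *m w = (kap * sigma * b)%:C%C *: delta_mx i0 ord0.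
Proof.
apply/matrixP => j k; rewrite ord1 modal_output -scalemxAr /v mulmxA.
rewrite -map_mxM UU map_mx1 mul1mx !mxE.
have [->|] := eqVneq j i0; last by rewrite !mulr0.
by rewrite !mulr1 /kap -!rmorphM/= !mulrA.
Qed.

Let gainE : kap * sigma * b = - sigma * h.
Proof.
have -> : h = alpha * kap / P by rewrite -critical; field; rewrite gt_eqF.
by rewrite /b; field; rewrite gt_eqF.
Qed.

Let cnorm2_delta : cnorm2 (delta_mx i0 ord0 : 'cV[R[i]]_d) = 1.
Proof.
apply/eqP; rewrite -sqrp_eq1 ?cnorm2_ge0//.
by rewrite -[delta_mx _ _]scale1r sqr_cnorm2_delta Normc.normc1 expr1n.
Qed.

Lemma Hinf_normE : Hinf_norm A B T = h%:E.
Proof.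
apply/eqP; rewrite eq_le; apply/andP; split.
  apply: ge_ereal_sup => _ [z /= z1 <-]; rewrite lee_fin.
  exact: transfer_norm_le.
have s1 : normc sigma%:C%C = 1 by rewrite normc_real.
apply: (@le_trans _ _ (spectral_norm (transfer A B T sigma%:C%C))%:E);
  last first.
  by apply: ereal_sup_ubound; exists sigma%:C%C.
rewrite lee_fin.
have v1 : cnorm2 v = 1 by rewrite cnorm2_orthogonal.
apply: le_trans (spectral_norm_ge _ v1).
rewrite /transfer -!mulmxA -(iffLR (resolventP _ _ s1) state)
  output cnorm2Z cnorm2_delta mulr1.
by rewrite normc_real gainE normrM normrN sigma_norm mul1r ger0_norm// ltW.
Qed.

(* The real rank-one feedback that closes the loop of the critical mode:
   Delta0 (T w) = v, so that w becomes an eigenvector for sigma. *)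
Let Delta0 : 'M[R]_d := (- sigma / h) *: (U *m delta_mx i0 i0).

Let norm_Delta0 : spectral_norm Delta0^C <= h^-1.
Proof.
apply: spectral_norm_le => [|x]; first by rewrite invr_ge0 ltW.
rewrite /Delta0 /complexify map_mxZ map_mxM map_delta_mx -scalemxAl cnorm2Z
  -mulmxA cnorm2_orthogonal//.
rewrite normc_real !normrM normrN sigma_norm mul1r ger0_norm ?invr_ge0 ?(ltW
  h_gt0)//.
rewrite ler_wpM2l// ?invr_ge0 ?(ltW h_gt0)//.
rewrite -ler_sqr ?nnegrE ?cnorm2_ge0// !sqr_cnorm2.
apply: ler_sum => j _; have [->|ji] := eqVneq j i0.
  rewrite mxE (bigD1 i0)//= mxE !eqxx mul1r big1 ?addr0// => k ki.
  by rewrite mxE (negPf ki) andbF mul0r.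
rewrite mxE big1 ?Normc.normc0 ?expr0n ?sqr_ge0// => k _.
by rewrite mxE (negPf ji) mul0r.
Qed.

Let destabilized : 1 <= spectral_radius (A^C + B^C *m Delta0^C *m T^C).
Proof.
rewrite -sigma_norm -normc_real; apply: spectral_radius_ge.
have sh : - sigma * h != 0.
  by rewrite mulf_neq0 ?(gt_eqF h_gt0)// oppr_eq0 -normr_eq0 sigma_norm
    oner_eq0.
apply/eigenvalue_colP; exists w.
  apply: contra sh => /eqP w0; have := output;
    rewrite w0 mulmx0 gainE => /esym/eqP.
  have d0 : (delta_mx i0 ord0 : 'cV[R[i]]_d) != 0.
    apply/eqP => d0; have := cnorm2_delta;
      rewrite d0 -(scale0r 0) cnorm2Z Normc.normc0 mul0r.
    by move/esym/eqP; rewrite oner_eq0.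
  by rewrite scaler_eq0 (negPf d0) orbF => /eqP[->].
rewrite mulmxDl -!mulmxA -state; congr (_ + _ *m _).
rewrite output gainE -scalemxAr /Delta0 /complexify map_mxZ map_mxM
  map_delta_mx.
rewrite -scalemxAl scalerA -rmorphM/=.
have -> : - sigma * h * (- sigma / h) = 1 by rewrite -sigma2; field;
  rewrite gt_eqF.
by rewrite scale1r -mulmxA mul_delta_mx.
Qed.

Lemma stability_radius_overE (D : set 'M[R[i]]_d) :
  range (@complexify R d d) `<=` D -> stability_radius_over A B T D = (h^-1)%:E.
Proof.
move=> realD; apply/eqP; rewrite eq_le; apply/andP; split.
  apply: ereal_inf_lbound; exists h^-1 => //=; split; first by rewrite invr_gt0.
  apply: (@le_trans _ _ (spectral_radius (A^C + B^C *m Delta0^C *m T^C))%:E).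
    by rewrite lee_fin.
  apply: ereal_sup_ubound; exists Delta0^C => //; split => //.
  by apply: realD; exists Delta0.
apply/ereal_infP => _ [eps /= [eps0 unstable] <-]; rewrite lee_fin leNgt.
apply/negP => eps_lt; have eh : eps * h < 1 by rewrite -ltr_pdivlMr// div1r.
have [eta /andP[_ eta1] bound] := perturbed_eigenvalue_bound (ltW eps0) eh.
suff : (perturbed_radius A B T D eps <= eta%:E)%E.
  by move=> /(le_trans unstable); rewrite lee_fin leNgt eta1.
by apply: ge_ereal_sup => _ [Delta [_ /= Deps] <-]; rewrite lee_fin bound.
Qed.

End Critical.
End FrequencyDomain.

(** * Quadratic objectives *)

Section Quadratic.
Variables (R : realType) (d : nat) (Q : 'M[R]_d) (p : 'cV[R]_d) (r : R).
Hypothesis Qsym : Q^T = Q.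
Local Notation f := (quadratic Q p r).

Lemma quadraticD x v : f (x + v) =
  f x + (v^T *m (Q *m x + p)) ord0 ord0 + 2^-1 * (v^T *m Q *m v) ord0 ord0.
Proof.
have sym : (x^T *m Q *m v) ord0 ord0 = (v^T *m Q *m x) ord0 ord0.
  by rewrite -[LHS]/((x^T *m Q *m v) ord0 ord0) -[in LHS](trmxK (_ *m v))
    mxE !trmx_mul trmxK Qsym mulmxA.
have psym : (p^T *m v) ord0 ord0 = (v^T *m p) ord0 ord0.
  by rewrite -[in LHS](trmxK (_ *m v)) mxE trmx_mul trmxK.
rewrite /quadratic [(x + v)^T]linearD/= !(mulmxDl,
  mulmxDr) [v^T *m (Q *m x)]mulmxA.
have mxDE (M N : 'M[R]_1) : (M + N) ord0 ord0 =
  M ord0 ord0 + N ord0 ord0 by rewrite mxE.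
by rewrite !mxDE sym psym; field.
Qed.

Lemma gradient_quadratic x : gradient f x = Q *m x + p.
Proof.
apply/matrixP => i j; rewrite ord1 mxE.
set v := delta_mx _ _.
have -> : (Q *m x + p) i ord0 = (v^T *m (Q *m x + p)) ord0 ord0.
  by rewrite /v trmx_delta -rowE [in RHS]mxE.
set D := (v^T *m (Q *m x + p)) ord0 ord0.
pose q := 2^-1 * (v^T *m Q *m v) ord0 ord0.
rewrite /derive; apply: cvg_lim => //.
have lin : (fun t : R => D + t * q) t @[t --> 0^'] --> D.
  rewrite -[X in _ --> X]addr0 -[X in _ + X](mul0r q).
  apply: cvgD; first exact: cvg_cst.
  by apply: cvgM; [exact: nbhs_dnbhs|exact: cvg_cst].
apply: cvg_trans lin; apply: near_eq_cvg.
near=> t.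
have t0 : t != 0 by near: t; exact: nbhs_dnbhs_neq.
rewrite /= [_ + x]addrC quadraticD linearZ/= -!scalemxAl -scalemxAr.
have mxZE (k : R) (M : 'M[R]_1) : (k *: M) ord0 ord0 =
  k * M ord0 ord0 by rewrite mxE.
rewrite !mxZE -/D /q /GRing.scale/=; field.
by rewrite t0.
Unshelve. all: by end_near.
Qed.

Hypothesis Qpos : posdefmx Q.

Lemma posdefmx_unit : Q \in unitmx.
Proof.
rewrite -row_free_unit; apply: contraT => notfree.
have /eigenvalue_colP[v v0 Qv] : eigenvalue Q 0.
  by rewrite /eigenvalue /eigenspace kermx_eq0 raddf0 subr0.
by have := Qpos v0; rewrite -mulmxA Qv scale0r mulmx0 mxE ltxx.
Qed.

(** The Newton step from the minimizer cannot decrease the objective. *)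
Lemma minimizer_stationary xs : is_minimizer f xs -> Q *m xs + p = 0.
Proof.
move=> min; set g := _ + _.
pose v := - (invmx Q *m g).
have Qv : Q *m v = - g by rewrite mulmxN mulKVmx// posdefmx_unit.
have [v0|v_neq0] := eqVneq v 0.
  by apply/eqP; rewrite -oppr_eq0 -Qv v0 mulmx0.
have contra (s t : R) : s <= s + t + 2^-1 * - t -> 0 < - t -> False by lra.
have := Qpos v_neq0; have := min (xs + v).
rewrite quadraticD -/g -mulmxA Qv mulmxN.
have -> : (- (v^T *m g)) ord0 ord0 = - (v^T *m g) ord0 ord0 by rewrite mxE.
by move=> /contra contra' /contra'.
Qed.

Lemma quadratic_minimizer xs x : is_minimizer f xs ->
  f x - f xs = 2^-1 * ((x - xs)^T *m Q *m (x - xs)) ord0 ord0.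
Proof.
move=> /minimizer_stationary st.
rewrite -{1}(subrK xs x) [_ - xs + xs]addrC quadraticD st mulmx0 mxE.
by ring.
Qed.

End Quadratic.

(** * The l2 gain *)

Lemma nneseries_le (R : realType) (u : nat -> R) (M : \bar R) :
  (forall k, 0 <= u k) -> (forall n, ((\sum_(0 <= k < n) u k)%:E <= M)%E) ->
  (\sum_(0 <= k <oo) (u k)%:E <= M)%E.
Proof.
move=> u0 uM; apply: lime_le.
  by apply: is_cvg_ereal_nneg_natsum => k _; rewrite lee_fin.
by near=> n; rewrite sumEFin.
Unshelve. all: by end_near.
Qed.

(** The mode is driven along a truncated sigma^j. Index j stands for time j - 1,
    so that the two leading zeros are the initial state at rest, x_(-1) and
    x_0. *)
Section ResonantPulse.
Variables (R : realType) (a c sigma : R) (n : nat).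
Hypothesis sigma2 : sigma ^+ 2 = 1.

Definition pulse (j : nat) : R := if (2 <= j < n.+4)%N then sigma ^+ j else 0.
(** The input that makes the recurrence follow the pulse. *)
Definition pulse_forcing (k : nat) : R :=
  pulse k.+2 - a * pulse k.+1 + c * pulse k.

Let sigma_sqr j : (sigma ^+ j) ^+ 2 = 1.
Proof. by rewrite exprAC sigma2 expr1n. Qed.

Let pulse_le1 j : `|pulse j| <= 1.
Proof.
rewrite /pulse; case: ifP => _; last by rewrite normr0.
by rewrite -[leRHS](expr1n _ 1) -(@ler_pXn2r _ 2)// ?nnegrE// expr1 real_normK
  ?num_real// sigma_sqr expr1n.
Qed.

Lemma sum_sqr_pulse : \sum_(0 <= k < n.+3) pulse k.+1 ^+ 2 = n.+2%:R.
Proof.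
rewrite big_nat_recl//= {1}/pulse /= expr0n add0r.
rewrite (eq_big_nat _ _ (F2 := fun=> 1)) => [|k /andP[_ kn]].
  by rewrite sumr_const_nat subn0.
by rewrite /pulse ifT ?sigma_sqr//; lia.
Qed.

(** Inside the pulse the forcing is p(sigma) sigma^k, as sigma = 1 or -1; only
    the four steps that meet its ends differ. *)
Lemma sum_sqr_pulse_forcing m : \sum_(0 <= k < m) pulse_forcing k ^+ 2 <=
  n%:R * (1 - a * sigma + c) ^+ 2 + 4 * (1 + `|a| + `|c|) ^+ 2.
Proof.
set C := (1 + `|a| + `|c|) ^+ 2; set I := (1 - a * sigma + c) ^+ 2.
have FC k : pulse_forcing k ^+ 2 <= C.
  rewrite -real_normK ?num_real// ler_sqr ?nnegrE ?addr_ge0//.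
  rewrite (le_trans (ler_normD _ _))// lerD//; last by rewrite normrM ler_piMr.
  rewrite (le_trans (ler_normB _ _))// lerD//.
  by rewrite normrM ler_piMr.
have Fint k : (2 <= k < n.+2)%N -> pulse_forcing k ^+ 2 = I.
  move=> /andP[k2 kn]; rewrite /pulse_forcing /pulse.
  rewrite (_ : (2 <= k.+2 < n.+4)%N); last by rewrite !ltnS; lia.
  rewrite (_ : (2 <= k.+1 < n.+4)%N); last by lia.
  rewrite (_ : (2 <= k < n.+4)%N); last by lia.
  rewrite /I -[LHS]mul1r -(sigma_sqr k) -exprMn.
  rewrite (_ : sigma ^+ k * _ = (sigma ^+ k) ^+ 2 * (sigma ^+ 2 - a * sigma +
    c)); last by rewrite !exprS; ring.
  by rewrite sigma_sqr sigma2 mul1r.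
have F0 k : (n.+4 <= k)%N -> pulse_forcing k ^+ 2 = 0.
  move=> nk; rewrite /pulse_forcing /pulse.
  rewrite !ifF ?mulr0 ?subr0 ?addr0 ?expr0n//; apply/negP; lia.
apply: (@le_trans _ _ (\sum_(0 <= k < n.+4 + m) pulse_forcing k ^+ 2)).
  rewrite (@big_cat_nat _ _ _ m 0 (n.+4 + m))//=; last by rewrite leq_addl.
  by rewrite lerDl sumr_ge0// => k _; exact: sqr_ge0.
rewrite (@big_cat_nat _ _ _ n.+4 0 (n.+4 + m))//=; last by rewrite leq_addr.
have -> : \sum_(n.+4 <= k < n.+4 + m) pulse_forcing k ^+ 2 = 0.
  by rewrite big_nat big1// => k /andP[nk _]; exact: F0.
rewrite addr0.
rewrite big_nat_recr//= big_nat_recr//= big_nat_recl//= big_nat_recl//=.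
rewrite (eq_big_nat _ _ (F2 := fun=> I)) => [|k /andP[_ kn]]; last first.
  by apply: Fint; lia.
rewrite sumr_const_nat subn0 -[I *+ n]mulr_natl.
have := FC 0; have := FC 1; have := FC n.+2; have := FC n.+3.
lra.
Qed.
End ResonantPulse.

Lemma archimedean_slope (R : realType) (x y C : R) :
  (forall n : nat, n%:R * x <= n%:R * y + C) -> x <= y.
Proof.
move=> xy; rewrite leNgt; apply/negP => yx.
have xy0 : 0 < x - y by rewrite subr_gt0.
have := xy (Num.bound `|C / (x - y)|); rewrite -lerBlDl -mulrBr leNgt => /negP;
  apply.
by rewrite -ltr_pdivrMr// (le_lt_trans (ler_norm _))// archi_boundP.
Qed.

Section TimeDomain.
Variables (R : realType) (d : nat) (Q U : 'M[R]_d) (lam : 'rV[R]_d).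
Variables (p xs : 'cV[R]_d) (r alpha beta nu h : R).
Hypothesis Qsym : Q^T = Q.
Hypothesis Qpos : posdefmx Q.
Hypothesis UU : U^T *m U = 1%:M.
Hypothesis QE : Q = U *m diag_mx lam *m U^T.
Hypothesis fxs : is_minimizer (quadratic Q p r) xs.
Hypothesis alpha_gt0 : 0 < alpha.
Hypothesis lam_gt0 : forall i, 0 < lam ord0 i.
Hypothesis h_gt0 : 0 < h.
Local Notation f := (quadratic Q p r).
Let a i := mode_trace alpha beta nu (lam ord0 i).
Let c i := mode_det alpha beta nu (lam ord0 i).
Let e i := alpha ^+ 2 * lam ord0 i / (2 * h ^+ 2).

Definition modal (x : 'cV[R]_d) (i : 'I_d) : R := (U^T *m (x - xs)) i ord0.

Lemma quadratic_modal x : f x - f xs = \sum_i lam ord0 i / 2 * modal x i ^+ 2.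
Proof.
rewrite (quadratic_minimizer Qsym Qpos)// QE !mulmxA -mulmxA.
rewrite (_ : (x - xs)^T *m U = (U^T *m (x - xs))^T);
  last by rewrite trmx_mul trmxK.
rewrite -mulmxA mul_diag_mx mxE mulr_sumr; apply: eq_bigr => i _.
by rewrite [_^T _ _]mxE [(\matrix_(_, _) _) _ _]mxE /modal; ring.
Qed.

(** The gradient being affine and zero at xs, the error x - xs follows a linear
    recurrence, diagonal in the coordinates of U. *)
Lemma modal_recurrence w x0 k i :
  let: (x, xprev) := gmm_state alpha beta nu f w x0 k in
  modal (gmm_state alpha beta nu f w x0 k.+1).1 i =
  a i * modal x i - c i * modal xprev i - alpha * (U^T *m w k) i ord0.
Proof.
rewrite /=; case: (gmm_state _ _ _ _ _ _ k) => x xprev /=.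
rewrite gradient_quadratic//.
have st := minimizer_stationary Qsym Qpos fxs.
have dE : x - xprev = (x - xs) - (xprev - xs) by rewrite opprB addrA subrK.
have -> : Q *m (x + nu *: (x - xprev)) + p =
  Q *m ((x - xs) + nu *: (x - xprev)).
  rewrite -[LHS]subr0 -st opprD addrACA subrr addr0 -mulmxBr; congr (_ *m _).
  by rewrite addrAC.
rewrite /modal.
have shift (y z : 'cV[R]_d) : x - y + z - xs = (x - xs) - y + z.
  by rewrite addrAC [in LHS](addrAC x).
rewrite shift dE.
move: (x - xs) (xprev - xs) => s t.
have UQ : U^T *m Q = diag_mx lam *m U^T by rewrite QE !mulmxA UU mul1mx.
rewrite !(mulmxDr, mulmxN) -!scalemxAr !(mulmxDr, mulmxN) -!scalemxAr !(mulmxDr,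
  mulmxN) !mulmxA UQ -!mulmxA mul_diag_mx.
rewrite !mul_diag_mx; move: (U^T *m s) (U^T *m t) (U^T *m w k) => {}s {}t u.
by rewrite !mxE /a /c /mode_trace /mode_det; ring.
Qed.

Section UpperBound.
Variables (v11 v12 v22 : 'I_d -> R).
Hypothesis certified : forall i, storage (a i) (c i) (e i) (v11 i) (v12 i)
  (v22 i).
(* Storage of the whole state: the sum over the modes, rescaled so that the
   dissipated energy is the suboptimality f x - f xs. *)
Let S x xprev := h ^+ 2 / alpha ^+ 2 *
  \sum_i qform (v11 i) (v12 i) (v22 i) (modal x i) (modal xprev i).

Let S_ge0 x y : 0 <= S x y.
Proof.
rewrite /S mulr_ge0 ?divr_ge0 ?sqr_ge0// sumr_ge0// => i _.
exact: (proj1 (certified i)).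
Qed.

Let S_step w x0 k :
  forall st, st = gmm_state alpha beta nu f w x0 ->
  f (st k).1 - f xs + S (st k.+1).1 (st k.+1).2 <=
    h ^+ 2 * norm2 (w k) ^+ 2 + S (st k).1 (st k).2.
Proof.
move=> st ->; clear st.
pose st := gmm_state alpha beta nu f w x0; rewrite -/st.
have nw : norm2 (w k) ^+ 2 = \sum_i (U^T *m w k) i ord0 ^+ 2.
  rewrite orthogonal_sum_sqr; last by rewrite trmxK (mulmx1C UU).
  by rewrite sqr_sqrtr// sumr_ge0// => i _; rewrite sqr_ge0.
rewrite quadratic_modal nw /S !mulr_sumr -!big_split/=; apply: ler_sum => i _.
have := modal_recurrence w x0 k i.
have -> : (st k.+1).2 = (st k).1 by rewrite /st /=;
  case: (gmm_state _ _ _ _ _ _ k).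
rewrite /st; case: (gmm_state _ _ _ _ _ _ k) => x xprev rec.
have := proj2 (certified i) (modal (gmm_state alpha beta nu f w x0 k.+1).1 i)
  (modal x i) (modal xprev i).
have ha : 0 <= h ^+ 2 / alpha ^+ 2 by rewrite divr_ge0 ?sqr_ge0.
move/(ler_wpM2l ha); rewrite !mulrDr.
have -> : h ^+ 2 / alpha ^+ 2 * (e i * modal x i ^+ 2) =
  lam ord0 i / 2 * modal x i ^+ 2.
  by rewrite /e; field; rewrite !gt_eqF.
have -> : h ^+ 2 / alpha ^+ 2 * (modal
  (gmm_state alpha beta nu f w x0 k.+1).1 i - a i * modal x i + c i *
  modal xprev i) ^+ 2
   = h ^+ 2 * (U^T *m w k) i ord0 ^+ 2.
  by rewrite rec; field; rewrite gt_eqF.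
by [].
Qed.

Lemma l2_gain_bound_certified : l2_gain_bound alpha beta nu f xs h.
Proof.
exists (fun x => S x x); split=> // [|x0 w _].
  rewrite /S big1 ?mulr0// => i _.
  by rewrite /qform /modal subrr mulmx0 mxE expr0n/= !mulr0 !addr0.
apply: nneseries_le => [k|n]; first by rewrite subr_ge0 fxs.
have part : \sum_(0 <= k < n) (f (gmm alpha beta nu f w x0 k) - f xs) <=
    h ^+ 2 * \sum_(0 <= k < n) norm2 (w k) ^+ 2 + S x0 x0.
  pose st := gmm_state alpha beta nu f w x0.
  suff : \sum_(0 <= k < n) (f (st k).1 - f xs) + S (st n).1 (st n).2 <=
    h ^+ 2 * \sum_(0 <= k < n) norm2 (w k) ^+ 2 + S x0 x0.
    by apply: le_trans; rewrite lerDl.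
  elim: n => [|n IH]; first by rewrite !big_geq// mulr0.
  rewrite !big_nat_recr//= mulrDr.
  have := S_step n (erefl st).
  by move: IH; lra.
apply: le_trans (_ : (h ^+ 2 * \sum_(0 <= k <
  n) norm2 (w k) ^+ 2 + S x0 x0)%:E <= _)%E; first by rewrite lee_fin.
rewrite EFinD EFinM leeD2r// lee_pmul2l// ?lte_fin ?exprn_gt0//.
rewrite -sumEFin; apply: nneseries_lim_ge => k _ _.
by rewrite lee_fin sqr_ge0.
Qed.

End UpperBound.

Section LowerBound.
Variables (i0 : 'I_d) (sigma : R).
Hypothesis sigma2 : sigma ^+ 2 = 1.
Let P := 1 - a i0 * sigma + c i0.
Hypothesis P_gt0 : 0 < P.
Hypothesis critical : h * P = alpha * ((Num.sqrt 2)^-1 * Num.sqrt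
  (lam ord0 i0)).
Let u := U *m (delta_mx i0 ord0 : 'cV_d).
Let s n := pulse sigma n.
Let w n k := (- (pulse_forcing (a i0) (c i0) sigma n k / alpha)) *: u.

Let Qu : Q *m u = lam ord0 i0 *: u.
Proof. exact: (diagonalized_eigenvector UU QE). Qed.

Let pulse_state n k : gmm_state alpha beta nu f (w n) xs k =
  (xs + s n k.+1 *: u, xs + s n k *: u).
Proof.
elim: k => [|k IH]; first by rewrite /= /s /pulse /= scale0r addr0.
rewrite [LHS]/= IH; congr pair; rewrite gradient_quadratic//.
have diff : xs + s n k.+1 *: u - (xs + s n k *: u) = (s n k.+1 - s n k) *: u.
  by rewrite opprD addrACA subrr add0r scalerBl.
rewrite diff; set y := _ + nu *: _.
have -> : Q *m y + p = ((s n k.+1 + nu * (s n k.+1 - s n k)) *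
  lam ord0 i0) *: u.
  have -> : y = xs + (s n k.+1 + nu * (s n k.+1 - s n k)) *: u.
    by rewrite /y scalerA -addrA -scalerDl.
  by rewrite mulmxDr addrAC (minimizer_stationary Qsym Qpos fxs)
    add0r -scalemxAr Qu scalerA.
rewrite /w !scalerA -scalerDl scalerA -!addrA -scaleNr -!scalerDl;
  congr (_ + _ *: _).
by rewrite /s /pulse_forcing /a /c /mode_trace /mode_det; field; rewrite gt_eqF.
Qed.

(** The method is started at xs, where H vanishes, and driven along pulses of
    growing length n. Both sides grow linearly in n, and comparing the slopes
    gives lam / 2 <= gamma^2 p(sigma)^2 / alpha^2, that is h <= gamma. *)
Lemma l2_gain_bound_ge gamma : 0 < gamma ->
  l2_gain_bound alpha beta nu f xs gamma -> h <= gamma.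
Proof.
move=> gamma_gt0 [H [H_ge0 Hxs gain]].
have modal_u t i : modal (xs + t *: u) i = t * (i == i0)%:R.
  rewrite /modal [xs + _]addrC addrK -scalemxAr /u mulmxA UU mul1mx !mxE.
  by rewrite eqxx andbT.
have f_pulse n k : f (gmm alpha beta nu f (w n) xs k) - f xs =
  lam ord0 i0 / 2 * s n k.+1 ^+ 2.
  rewrite /gmm pulse_state quadratic_modal (bigD1 i0)//= modal_u eqxx mulr1.
  by rewrite big1 ?addr0// => i ii; rewrite modal_u (negPf ii)
    mulr0 expr0n mulr0.
have w_norm n k : norm2 (w n k) ^+ 2 =
  pulse_forcing (a i0) (c i0) sigma n k ^+ 2 / alpha ^+ 2.
  rewrite sqr_sqrtr ?sumr_ge0// => [|i _]; last exact: sqr_ge0.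
  rewrite /w /u scalemxAr orthogonal_sum_sqr// (bigD1 i0)//= big1 => [|i ii].
    by rewrite !mxE !eqxx mulr1 addr0 sqrrN expr_div_n.
  by rewrite !mxE (negPf ii) mulr0 expr0n.
pose C := 4 * (1 + `|a i0| + `|c i0|) ^+ 2.
have w_sum n m : \sum_(0 <= k < m) norm2 (w n k) ^+ 2 <=
  (n%:R * P ^+ 2 + C) / alpha ^+ 2.
  under eq_bigr do rewrite w_norm.
  rewrite -mulr_suml ler_wpM2r ?invr_ge0 ?sqr_ge0//.
  exact: sum_sqr_pulse_forcing.
have summ n : square_summable (w n).
  apply: nondecreasing_is_cvgn.
    by apply: nondecreasing_series => k _ _; exact: sqr_ge0.
  by exists ((n%:R * P ^+ 2 + C) / alpha ^+ 2) => _ [m _ <-]; exact: w_sum.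
have step n : n%:R * (lam ord0 i0 / 2) <=
  n%:R * (gamma ^+ 2 * P ^+ 2 / alpha ^+ 2) + gamma ^+ 2 * C / alpha ^+ 2.
  rewrite -lee_fin; have := gain xs (w n) (summ n); rewrite Hxs adde0 => gn.
  apply: (@le_trans _ _ (\sum_(0 <= k <
    n.+3) (f (gmm alpha beta nu f (w n) xs k) - f xs))%:E).
    rewrite lee_fin; under eq_bigr do rewrite f_pulse.
    rewrite -mulr_sumr sum_sqr_pulse// mulrC ler_pM2l ?ler_nat; first lia.
    by rewrite divr_gt0.
  rewrite -sumEFin; apply: le_trans (nneseries_lim_ge _ _) _ => [k _ _|].
    by rewrite lee_fin subr_ge0.
  apply: le_trans gn _.
  rewrite (_ : _ + _ = gamma ^+ 2 * ((n%:R * P ^+ 2 + C) / alpha ^+ 2));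
    last by ring.
  rewrite [leRHS]EFinM lee_pmul2l ?lte_fin ?exprn_gt0//.
  by apply: nneseries_le => [k|m]; [exact: sqr_ge0|rewrite lee_fin].
have := archimedean_slope step.
rewrite ler_pdivlMr ?exprn_gt0// => le_gP.
rewrite -ler_sqr ?nnegrE ?(ltW h_gt0) ?(ltW gamma_gt0)//.
rewrite -(ler_pM2r (exprn_gt0 2 P_gt0)); apply: le_trans le_gP.
rewrite -exprMn critical !exprMn exprVn !sqr_sqrtr ?ler0n ?(ltW (lam_gt0 _))//.
by rewrite le_eqVlt; apply/orP; left; apply/eqP; field.
Qed.

End LowerBound.
End TimeDomain.

(** * Equality of the robustness measures *)

Theorem corollary4p8 (R : realType) (d : nat) (Q : 'M[R]_d) (p : 'cV[R]_d)
    (r mu L : R) (U : 'M[R]_d) (lam : 'rV[R]_d) (xs : 'cV[R]_d)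
    (alpha beta nu : R)
    (Qsym : Q^T = Q)
    (Qpos : posdefmx Q)
    (Qmu : is_min_eigenvalue Q mu)
    (QL : is_max_eigenvalue Q L)
    (muL : 0 < mu < L)
    (QU : orthogonal_eigendecomposition Q U lam)
    (fxs : is_minimizer (quadratic Q p r) xs)
    (params : gmm_parameters mu L alpha beta nu) :
  let A := gmm_A alpha beta nu Q in
  let B := gmm_B d alpha in
  let T := gmm_T U lam in
  [/\ spectral_radius (complexify A) < 1,
      stability_radiusR A B T = stability_radiusC A B T,
      stability_radiusC A B T = ((Hinf_norm A B T)^-1)%E
    & ((Hinf_norm A B T)^-1)%E =
      ((l2_gain alpha beta nu (quadratic Q p r) xs)^-1)%E].
Proof.
move=> A B T; have [UU QE _] := QU.
have adm := admissible_params muL params.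
have al_gt0 : 0 < alpha by case: adm.
have [h [h_gt0 cert [l [sigma [l_end sigma2 P_gt0 crit]]]]] := admissible_gain muL adm.
have lam_itv i : mu <= lam ord0 i <= L.
  have ev : eigenvalue Q (lam ord0 i) by apply/(eigenvalue_diagonalized UU QE); exists i.
  by rewrite (proj2 Qmu)// (proj2 QL).
have lam_gt0 i : 0 < lam ord0 i.
  by case/andP: muL (lam_itv i) => mu0 _ /andP[/(lt_le_trans mu0)].
have [i0 lam_i0] : exists i, lam ord0 i = l.
  apply/(eigenvalue_diagonalized UU QE).
  by case: l_end => ->; [exact: (proj1 Qmu)|exact: (proj1 QL)].
subst l.
have certified i := cert _ (lam_itv i).
have HinfE : Hinf_norm A B T = h%:E.
  exact: (Hinf_normE UU QE al_gt0 lam_gt0 h_gt0 certified sigma2 P_gt0 crit).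
have radius D : range (@complexify R d d) `<=` D -> stability_radius_over A B T D = (h^-1)%:E.
  exact: (stability_radius_overE UU QE al_gt0 lam_gt0 h_gt0 certified sigma2 P_gt0 crit).
have gainE : l2_gain alpha beta nu (quadratic Q p r) xs = h%:E.
  apply/eqP; rewrite eq_le; apply/andP; split.
    apply: ereal_inf_lbound; exists h => //; split=> //.
    have /choice[v11 /choice[v12 /choice[v22 st]]] :
      forall i, exists v11 v12 v22, storage _ _ _ v11 v12 v22 := certified.
    exact: (l2_gain_bound_certified Qsym Qpos UU QE fxs al_gt0 h_gt0 st).
  apply/ereal_infP => _ [gamma [gamma_gt0 bound] <-]; rewrite lee_fin.
  exact: (l2_gain_bound_ge Qsym Qpos UU QE fxs al_gt0 lam_gt0 h_gt0 sigma2 P_gt0 crit gamma_gt0 bound).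
split.
- exact: (gmm_A_stable UU QE al_gt0 lam_gt0 h_gt0 certified).
- by rewrite /stability_radiusR /stability_radiusC !radius.
- by rewrite /stability_radiusC radius// HinfE inver gt_eqF.
- by rewrite HinfE gainE.
Qed.
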